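(* Let $i\in\mathbb{N}$, $\alpha\in\mathbb{R}$ and $\beta\ge0$. (1) The function $x\mapsto\frac{\alpha}{x}\bigl|\psi^{(i)}(x)\bigr|-\bigl|\psi^{(i+1)}(x)\bigr|$ is completely monotonic on $(0,\infty)$ if and only if $\alpha\ge i+1$. (2) The function $x\mapsto\bigl|\psi^{(i+1)}(x)\bigr|-\frac{\alpha}{x}\bigl|\psi^{(i)}(x)\bigr|$ (the negative of the function in (1)) is completely monotonic on $(0,\infty)$ if and only if $\alpha\le i$. (3) If $\beta\ge\frac12$, then the function $x\mapsto\frac{\alpha}{x}\bigl|\psi^{(i)}(x+\beta)\bigr|-\bigl|\psi^{(i+1)}(x+\beta)\bigr|$ is completely monotonic on $(0,\infty)$ if and only if $\alpha\ge i$. (4) If $0<\beta<\frac12$ and $$\alpha\ge i+1-\biggl[\frac{e^{\delta^{-1}(\beta)}}{e^{\delta^{-1}(\beta)}-1}+\beta-1\biggr]\delta^{-1}(\beta),$$ then the function $x\mapsto\frac{\alpha}{x}\bigl|\psi^{(i)}(x+\beta)\bigr|-\bigl|\psi^{(i+1)}(x+\beta)\bigr|$ is completely monotonic on $(0,\infty)$.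
   Context: Here $\mathbb{N}=\{1,2,3,\dots\}$. For $x>0$, $\Gamma(x)=\int_0^\infty t^{x-1}e^{-t}\,dt$ is the Euler gamma function, $\psi(x)=\Gamma'(x)/\Gamma(x)$ is the psi (digamma) function, and $\psi^{(k)}$ for $k\in\mathbb{N}$ denotes the $k$-th derivative of $\psi$ (a polygamma function). A function $f$ is completely monotonic on an interval $I\subseteq\mathbb{R}$ if $f$ has derivatives of all orders on $I$ and $0\le(-1)^kf^{(k)}(x)<\infty$ for all $x\in I$ and all integers $k\ge0$. The function $\delta:(0,\infty)\to\bigl(0,\frac12\bigr)$ is defined by $\delta(t)=\frac{e^t(t-1)+1}{(e^t-1)^2}$; it is a strictly decreasing bijection from $(0,\infty)$ onto $\bigl(0,\frac12\bigr)$, and $\delta^{-1}:\bigl(0,\frac12\bigr)\to(0,\infty)$ denotes its inverse function. *)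

(* Defs.v *)
From HB Require Import structures.
From mathcomp Require Import all_boot all_order all_algebra.
From mathcomp Require Import all_classical all_reals all_analysis.
Set Implicit Arguments.
Unset Strict Implicit.
Unset Printing Implicit Defensive.
Import Order.TTheory GRing.Theory Num.Theory.
Import numFieldNormedType.Exports.

Local Open Scope classical_set_scope.
Local Open Scope ring_scope.

(* The definitions Gamma, digamma, polygamma and delta are total functions on
   R; they carry their usual meaning only at positive arguments. *)
Definition Gamma (R : realType) (x : R) : R :=
  \int[lebesgue_measure]_(t in `]0, +oo[) (t `^ (x - 1) * expR (- t)).

Definition digamma (R : realType) (x : R) : R := (@Gamma R)^`()%classic x / Gamma x.

Definition polygamma (R : realType) (k : nat) (x : R) : R :=
  (@digamma R)^`(k)%classic x.

(* The derivatives are two-sided, so this is the usual notion when the interval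
   I is open; the values of f outside I then play no role. *)
Definition completely_monotonic (R : realType) (I : set R) (f : R -> R) : Prop :=
  forall (k : nat) (x : R), I x ->
    derivable (f^`(k)%classic) x 1 /\ 0 <= (-1) ^+ k * f^`(k)%classic x.

Definition delta (R : realType) (t : R) : R :=
  (expR t * (t - 1) + 1) / (expR t - 1) ^+ 2.

(* The inverse of delta : ]0, +oo[ -> ]0, 1/2[; the default value 0 is only
   taken outside the range of delta. *)
Definition delta_inv (R : realType) : R -> R :=
  'pinv_(fun=> 0) `]0, +oo[ (@delta R).

(* Main.v *)
(* Up to sign, the [i]-th polygamma function is [i! * zeta(i + 1, x)] with
   [zeta(j, x) = \sum_n (x + n)^-j] the Hurwitz zeta function: Wendel's inequality
   [Gamma (x + s) <= x^s * Gamma x] and the recurrence of [Gamma] determine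
   [ln Gamma] up to a constant, which yields the series of the digamma function.
   Each function of the statement is [G x / x], and up to sign the [k]-th
   derivative of [G] has the shape of [G] itself, with [i] and [alpha] both
   increased by [k]. So complete monotonicity only requires the inequality
   [(m + 1 - c) zeta(m + 1, y) >= (m + 1) (y - b) zeta(m + 2, y)] (or its reverse)
   for all [m >= i]. As [m! / (y + n)^(m + 1)] is the integral of
   [t^m exp(-(y + n) t)], summing over [n] under the integral reduces it to the
   pointwise inequality [c <= t / (exp t - 1) + b t] (or its reverse); the
   right-hand side has derivative [b - delta t], hence its minimum is at
   [delta_inv b]. The necessary conditions come from the behaviour of
   [x zeta(i + 2, x) / zeta(i + 1, x)] at [0] and at infinity. *)
Require Import Defs.
From HB Require Import structures.
From mathcomp Require Import all_boot all_order all_algebra.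
From mathcomp Require Import all_classical all_reals all_analysis.
From mathcomp Require Import measurable_realfun ring lra.
Import Order.TTheory GRing.Theory Num.Theory.
Import numFieldNormedType.Exports.
Local Open Scope classical_set_scope.
Local Open Scope ring_scope.
Set Implicit Arguments.
Unset Strict Implicit.
Unset Printing Implicit Defensive.

(** * The Gamma integral *)

(** The scale [u] gives the kernel two roles: [u = 1] yields [Gamma], and [u = y + n] with a natural
    [x] yields the Laplace kernels of the Hurwitz terms. *)
Definition gamma_kernel (R : realType) (x u t : R) : R := t `^ (x - 1) * expR (- (u * t)).

(** Its values are extended reals, so the recurrence and Wendel's inequality can be proved first and
    finiteness deduced from them. *)
Definition gamma_integral (R : realType) (x u : R) : \bar R :=
  (\int[lebesgue_measure]_(t in `]0%R, +oo[) (gamma_kernel x u t)%:E)%E.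

Lemma gamma_kernel_ge0 (R : realType) (x u t : R) : 0 <= gamma_kernel x u t.
Proof. by rewrite mulr_ge0 ?powR_ge0 ?expR_ge0. Qed.

Lemma measurable_gamma_kernel (R : realType) (x u : R) (D : set R) :
  measurable_fun D (EFin \o gamma_kernel x u).
Proof.
apply/measurable_EFinP; apply: measurable_funTS.
apply: measurable_funM; first exact: measurable_powR.
by apply: measurableT_comp => //; apply: measurableT_comp.
Qed.

Lemma is_derive_expRNM (R : realType) (u t : R) :
  is_derive t 1 (fun s => expR (- (u * s))) (- u * expR (- (u * t))).
Proof.
have h : is_derive t 1 (fun s : R => - (u * s)) (- u).
  have := is_deriveN (is_deriveZ u (is_derive_id t (1 : R))).
  by rewrite /GRing.scale /= mulr1.
rewrite mulrC.
exact: (@is_derive1_comp _ expR (fun s => - (u * s)) t _ _ (is_derive_expR _) h).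
Qed.

Lemma is_derive_LRcontinuous (R : realType) (F f : R -> R) (a b : R) :
  a < b -> {in `[a, b], forall t : R, is_derive t 1 F (f t)} ->
  derivable_oo_LRcontinuous F a b.
Proof.
move=> ab dF; have cF t : t \in `[a, b] -> F x @[x --> t] --> F t.
  move=> /dF [dFt _].
  exact/differentiable_continuous/derivable1_diffP.
split.
- move=> t tab; have /dF [] // : t \in `[a, b] by apply: subset_itv_oo_cc tab.
- by apply/cvg_at_right_filter/cF; rewrite in_itv /= lexx ltW.
- by apply/cvg_at_left_filter/cF; rewrite in_itv /= lexx ltW.
Qed.

(** Integration by parts of [expR (- (u * t))] against the derivative of [t ^ x]. The boundary terms
    stand on opposite sides, so that no subtraction of extended reals occurs. *)
Lemma gamma_kernel_by_parts (R : realType) (x u a b : R) : 0 < x -> 0 < u ->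
  0 < a -> a < b ->
  (x%:E * (\int[lebesgue_measure]_(t in `[a, b]) (gamma_kernel x u t)%:E)
   + (a `^ x * expR (- (u * a)))%:E =
   u%:E * (\int[lebesgue_measure]_(t in `[a, b]) (gamma_kernel (x + 1) u t)%:E)
   + (b `^ x * expR (- (u * b)))%:E)%E.
Proof.
move=> x0 u0 a0 ab.
pose E s := expR (- (u * s)); pose E' s := - u * expR (- (u * s)).
pose G s := s `^ x; pose g s := x * s `^ (x - 1).
have pos t : t \in `[a, b] -> 0 < t.
  by rewrite in_itv /= => /andP[at_ _]; exact: lt_le_trans at_.
have dE (t : R) : is_derive t 1 E (E' t) by exact: is_derive_expRNM.
have dG (t : R) : t \in `[a, b] -> is_derive t 1 G (g t).
  by move=> /pos t0; exact: is_derive1_powR.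
have := @integration_by_parts R E G E' g a b ab.
have cE' : {within `[a, b], continuous E'}.
  apply: derivable_within_continuous => t _.
  by apply: derivableM => //; have [] := dE t.
have cg : {within `[a, b], continuous g}.
  apply: derivable_within_continuous => t /pos t0.
  by apply: derivableM => //; apply: derivable_powR; rewrite in_itv /= t0.
have E't : {in `]a, b[, E^`()%classic =1 E'}.
  by move=> t _; rewrite derive1E; have [_ ->] := dE t.
have G't : {in `]a, b[, G^`()%classic =1 g}.
  move=> t tab; rewrite derive1E.
  by have [_ ->] : is_derive t 1 G (g t) by apply/dG/subset_itv_oo_cc.
move=> /(_ cE' (is_derive_LRcontinuous ab (fun t _ => dE t)) E't cg
  (is_derive_LRcontinuous ab dG) G't).
have -> : (\int[lebesgue_measure]_(t in `[a, b]) (E t * g t)%:E =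
    x%:E * \int[lebesgue_measure]_(t in `[a, b]) (gamma_kernel x u t)%:E)%E.
  rewrite -ge0_integralZl_EFin ?(ltW x0) //; last 2 first.
  - by move=> t _; rewrite lee_fin gamma_kernel_ge0.
  - exact: measurable_gamma_kernel.
  apply: eq_integral => t _; rewrite -EFinM; congr EFin.
  by rewrite /E /g /gamma_kernel; ring.
have -> : (\int[lebesgue_measure]_(t in `[a, b]) (E' t * G t)%:E =
    - (u%:E * \int[lebesgue_measure]_(t in `[a, b]) (gamma_kernel (x + 1) u t)%:E))%E.
  rewrite -ge0_integralZl_EFin ?(ltW u0) //; last 2 first.
  - by move=> t _; rewrite lee_fin gamma_kernel_ge0.
  - exact: measurable_gamma_kernel.
  rewrite -integral_ge0N; last first.
    by move=> t _; rewrite mule_ge0 ?lee_fin ?gamma_kernel_ge0 // ltW.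
  apply: eq_integral => t _; rewrite -EFinM -EFinN; congr EFin.
  by rewrite /E' /G /gamma_kernel addrK; ring.
rewrite oppeK => ->.
rewrite addeAC addeC -EFinD /E /G; congr (_ + EFin _)%E; ring.
Qed.

Lemma cvg_invSS (R : realType) : (n.+2%:R^-1 : R) @[n --> \oo] --> (0 : R).
Proof.
have := @cvg_harmonic R; rewrite -(cvg_shiftS (harmonic : R^nat)); exact.
Qed.

(** With a natural [m >= x], the bound [exp z >= z^(m+1) / (m+1)!] makes the product at most a
    constant times [1 / (n + 2)]. *)
Lemma powR_expR_cvg0 (R : realType) (x u : R) : 0 < u ->
  (n.+2%:R : R) `^ x * expR (- (u * n.+2%:R)) @[n --> \oo] --> (0 : R).
Proof.
move=> u0; have [m xm] : exists m : nat, x <= m%:R.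
  exists (Num.bound `|x|); rewrite (le_trans (ler_norm x)) // ltW //.
  exact: archi_boundP.
pose c : R := (m.+1)`!%:R / u ^+ m.+1.
apply: (@squeeze_cvgr _ _ _ _ (fun=> 0) (fun n => c * n.+2%:R^-1)).
- near=> n; rewrite mulr_ge0 ?powR_ge0 ?expR_ge0 //=.
  have b0 : 0 < (n.+2%:R : R) by [].
  have h1 : (n.+2%:R : R) `^ x <= n.+2%:R ^+ m.
    by rewrite -powR_mulrn // ler_powR // ler1n.
  have h2 : expR (- (u * n.+2%:R)) <= (m.+1)`!%:R / (u * n.+2%:R) ^+ m.+1.
    rewrite expRN -[leRHS]invrK lef_pV2 ?posrE ?expR_gt0 //; last first.
      by rewrite invr_gt0 divr_gt0 ?exprn_gt0 ?mulr_gt0 // ltr0n fact_gt0.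
    rewrite invf_div (le_trans _ (expR_ge1Dxn m _)) ?lerDr //.
    by rewrite mulr_ge0 // ltW.
  apply: (le_trans (ler_pM _ _ h1 h2)); rewrite ?powR_ge0 ?expR_ge0 //.
  rewrite /c exprMn exprS invfM.
  have -> : n.+2%:R ^+ m.+1 = n.+2%:R * n.+2%:R ^+ m :> R by rewrite exprS.
  rewrite le_eqVlt; apply/orP; left; apply/eqP; field.
  by rewrite !expf_neq0 ?gt_eqF.
- exact: cvg_cst.
- rewrite -(mulr0 c); apply: cvgM; [exact: cvg_cst|exact: cvg_invSS].
Unshelve. all: by end_near. Qed.

Lemma invSS_powR_expR_cvg0 (R : realType) (x u : R) : 0 < x -> 0 < u ->
  (n.+2%:R^-1 : R) `^ x * expR (- (u * n.+2%:R^-1)) @[n --> \oo] --> (0 : R).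
Proof.
move=> x0 u0.
apply: (@squeeze_cvgr _ _ _ _ (fun=> 0) (fun n => (n.+2%:R^-1 : R) `^ x)).
- near=> n; rewrite mulr_ge0 ?powR_ge0 ?expR_ge0 //=.
  by rewrite ler_piMr ?powR_ge0 // expR_le1 oppr_le0 mulr_ge0 // ltW.
- exact: cvg_cst.
- have /cvg_at_rightP h := powR_cvg0 x0.
  by apply: h; split; [move=> n; rewrite invr_gt0|exact: cvg_invSS].
Unshelve. all: by end_near. Qed.

(** Exhaustion by compact intervals away from [0]. The shift by two makes the endpoints distinct
    already at [n = 0], as integration by parts requires. *)
Lemma itvoy_bigcup_invSS (R : realType) :
  `]0, +oo[%classic = \bigcup_n `[n.+2%:R^-1 : R, n.+2%:R]%classic.
Proof.
apply/seteqP; split=> t /=.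
  rewrite in_itv /= andbT => t0.
  exists (maxn (Num.bound t) (Num.bound t^-1)) => //=; rewrite in_itv /=.
  have b s : 0 < s -> s <= (Num.bound s)%:R :> R.
    by move=> s0; apply/ltW/archi_boundP/ltW.
  apply/andP; split.
    rewrite -[leRHS]invrK lef_pV2 ?posrE ?invr_gt0 //.
    rewrite (le_trans (b _ _)) ?invr_gt0 // ler_nat.
    exact: leq_trans (leq_maxr _ _) (leqW (leqnSn _)).
  rewrite (le_trans (b _ _)) // ler_nat.
  exact: leq_trans (leq_maxl _ _) (leqW (leqnSn _)).
move=> [n _ /=]; rewrite !in_itv /= andbT => /andP[h _].
by rewrite (lt_le_trans _ h).
Qed.

Definition truncated_gamma_integral (R : realType) (x u : R) (n : nat) : \bar R :=
  (\int[lebesgue_measure]_(t in `[n.+2%:R^-1%R, n.+2%:R%R]) (gamma_kernel x u t)%:E)%E.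

Lemma truncated_gamma_integral_cvg (R : realType) (x u : R) :
  truncated_gamma_integral x u n @[n --> \oo] --> gamma_integral x u.
Proof.
rewrite /gamma_integral itvoy_bigcup_invSS.
apply: ge0_nondecreasing_set_cvg_integral.
- move=> m n mn; apply/subsetPset => t /=; rewrite !in_itv /= => /andP[mt tm].
  rewrite (le_trans _ mt) ?lef_pV2 ?posrE ?ler_nat //=.
  by rewrite (le_trans tm) // ler_nat.
- by move=> n.
- by move=> n; exact: measurable_gamma_kernel.
- by move=> n t _; rewrite lee_fin gamma_kernel_ge0.
Qed.

(** Limit of the integration by parts on the compact intervals: both boundary terms vanish, and the
    truncated integrals converge monotonically. *)
Lemma gamma_integralS (R : realType) (x u : R) : 0 < x -> 0 < u ->
  (u%:E * gamma_integral (x + 1) u = x%:E * gamma_integral x u)%E.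
Proof.
move=> x0 u0; symmetry.
have L (y v : R) (w : nat -> R) : w n @[n --> \oo] --> (0 : R) ->
    (v%:E * truncated_gamma_integral y u n + (w n)%:E)%E @[n --> \oo]
    --> (v%:E * gamma_integral y u)%E.
  move=> w0; rewrite -[X in _ --> X]adde0; apply: cvgeD.
  - by rewrite fin_num_adde_defl.
  - by apply: cvgeZl => //; exact: truncated_gamma_integral_cvg.
  - by apply: cvg_EFin => //; near=> n.
have H1 := L x x _ (invSS_powR_expR_cvg0 x0 u0).
have H2 := L (x + 1) u _ (powR_expR_cvg0 x u0).
apply: (cvg_unique (@ereal_hausdorff R) H1).
rewrite (_ : (fun n : nat => _) = (fun n : nat =>
  (u%:E * truncated_gamma_integral (x + 1) u n +
   ((n.+2%:R : R) `^ x * expR (- (u * n.+2%:R)))%:E)%E)) //.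
apply/funext => n; apply: gamma_kernel_by_parts => //.
by rewrite (@lt_trans _ _ 1) ?invf_lt1 ?ltr1n.
Unshelve. all: by end_near. Qed.

(** Convexity of the exponential: [r] and [1] are its values at [ln r] and [0], and [a = s * ln r]
    is the mean of these points with weights [s] and [1 - s]. The two tangent bounds at [a] then
    average to the claim. *)
Lemma powR_bernoulli (R : realType) (r s : R) : 0 < r -> 0 <= s <= 1 ->
  r `^ s <= 1 + s * (r - 1).
Proof.
move=> r0 /andP[s0 s1].
have -> : r `^ s = expR (s * ln r) by rewrite /powR gt_eqF.
set a := s * ln r; have ea := expR_gt0 a.
have h1 := expR_ge1Dx (ln r - a); have h2 := expR_ge1Dx (- a).
have e1 : r = expR a * expR (ln r - a).
  by rewrite -expRD addrC subrK lnK.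
have e2 : 1 = expR a * expR (- a) by rewrite -expRD subrr expR0.
rewrite [leRHS](_ : _ = expR a * (s * expR (ln r - a) + (1 - s) * expR (- a))); last first.
  transitivity (s * (expR a * expR (ln r - a)) + (1 - s) * (expR a * expR (- a))).
    by rewrite -e1 -e2; ring.
  by ring.
rewrite ler_peMr ?(ltW ea) //.
rewrite [leLHS](_ : _ = s * (1 + (ln r - a)) + (1 - s) * (1 - a)); last first.
  by rewrite /a; ring.
by apply: lerD; apply: ler_wpM2l => //; rewrite subr_ge0.
Qed.

Lemma gamma_integral1 (R : realType) (u : R) : 0 < u ->
  gamma_integral 1 u = (u^-1)%:E.
Proof.
move=> u0; pose f (t : R) := expR (- (u * t)); pose F (t : R) := - u^-1 * f t.
have df (t : R) : is_derive t 1 f (- u * expR (- (u * t))) by exact: is_derive_expRNM.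
have dF (t : R) : is_derive t 1 F (f t).
  have := is_deriveZ (- u^-1) (df t); rewrite /GRing.scale /= mulrA.
  by rewrite mulrNN mulVf ?gt_eqF // mul1r.
have cF (t : R) : F x @[x --> t] --> F t.
  by have [dFt _] := dF t; exact/differentiable_continuous/derivable1_diffP.
have cf (t : R) : f x @[x --> t] --> f t.
  by have [dft _] := df t; exact/differentiable_continuous/derivable1_diffP.
transitivity (\int[lebesgue_measure]_(t in `[0%R, +oo[) (f t)%:E)%E.
  rewrite -integral_itv_obnd_cbnd; last first.
    apply/measurable_EFinP; apply: measurable_funTS.
    exact: continuous_measurable_fun.
  apply: eq_integral => t; rewrite inE /= in_itv /= andbT => t0.
  by rewrite /gamma_kernel subrr powRr0 mul1r.
rewrite (@ge0_continuous_FTC2y _ f F 0 0).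
- by rewrite /F /f mulr0 oppr0 expR0 mulr1 sub0e -EFinN opprK.
- by move=> x _; exact: expR_ge0.
- by apply: continuous_subspaceT.
- rewrite -(mulr0 (- u^-1)); apply: cvgM; first exact: cvg_cst.
  apply: (@cvg_comp _ _ _ (fun t => u * t) (fun t => expR (- t)) _ +oo%R).
    exact: gt0_cvgMry.
  exact: cvgr_expR.
- by move=> x _; have [] := dF x.
- by apply: cvg_at_right_filter; exact: cF.
- by move=> x _; rewrite derive1E; have [_ ->] := dF x.
Qed.

Lemma gamma_integral_natS (R : realType) (m : nat) (u : R) : 0 < u ->
  gamma_integral m.+1%:R u = (m`!%:R / u ^+ m.+1)%:E.
Proof.
move=> u0; elim: m => [|m IH]; first by rewrite gamma_integral1 // expr1 div1r.
have := @gamma_integralS R m.+1%:R u (ltr0Sn _ _) u0.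
rewrite IH natr1 => h.
have -> : gamma_integral m.+2%:R u = (u^-1%:E * (u%:E * gamma_integral m.+2%:R u))%E.
  by rewrite muleA -EFinM mulVf ?gt_eqF // mul1e.
rewrite h -!EFinM; congr EFin; rewrite factS natrM [in RHS]exprS; field.
by rewrite expf_neq0 ?gt_eqF.
Qed.

(** The bound on [(t / x) ^ s] from [powR_bernoulli] is integrated against the kernel. The result
    combines the integrals at [x] and [x + 1], and the recurrence collapses it to [x ^ s] times the
    integral at [x]. *)
Lemma gamma_integral_wendel (R : realType) (x s : R) : 0 < x -> 0 <= s <= 1 ->
  (gamma_integral (x + s) 1 <= (x `^ s)%:E * gamma_integral x 1)%E.
Proof.
move=> x0 /[dup] s01 /andP[s0 s1].
have k0 := @gamma_kernel_ge0 R.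
have I0 y : (0 <= gamma_integral y (1 : R))%E.
  by apply: integral_ge0 => t _; rewrite lee_fin k0.
have c1 : 0 <= x `^ s * (1 - s) by rewrite mulr_ge0 ?powR_ge0 ?subr_ge0.
have c2 : 0 <= x `^ s * s / x by rewrite !mulr_ge0 ?powR_ge0 // invr_ge0 ltW.
have -> : ((x `^ s)%:E * gamma_integral x 1 =
   (x `^ s * (1 - s))%:E * gamma_integral x 1 +
   (x `^ s * s / x)%:E * gamma_integral (x + 1) 1)%E.
  have := @gamma_integralS R x 1 x0 ltr01; rewrite mul1e => ->.
  rewrite muleA -EFinM divfK ?gt_eqF // -ge0_muleDl; last 2 first.
  - by rewrite lee_fin.
  - by rewrite lee_fin mulr_ge0 // powR_ge0.
  by rewrite -EFinD -mulrDr subrK mulr1.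
have Z (c y : R) : 0 <= c -> (c%:E * gamma_integral y 1 =
    \int[lebesgue_measure]_(t in `]0%R, +oo[) (c * gamma_kernel y 1 t)%:E)%E.
  move=> c0; rewrite /gamma_integral -ge0_integralZl_EFin //.
  - by move=> t _; rewrite lee_fin k0.
  - exact: measurable_gamma_kernel.
have mk (c y : R) (D : set R) : measurable_fun D (fun t => (c * gamma_kernel y 1 t)%:E).
  apply/measurable_EFinP; apply: measurable_funM => //.
  by apply/measurable_EFinP; exact: measurable_gamma_kernel.
rewrite !Z // -ge0_integralD //; last 4 first.
- by move=> t _; rewrite lee_fin mulr_ge0.
- exact: mk.
- by move=> t _; rewrite lee_fin mulr_ge0.
- exact: mk.
apply: ge0_le_integral => //.
- by move=> t _; rewrite lee_fin k0.
- exact: measurable_gamma_kernel.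
- by apply: emeasurable_funD; exact: mk.
move=> t /=; rewrite in_itv /= andbT => t0.
rewrite -EFinD lee_fin /gamma_kernel addrK mul1r.
have -> : t `^ (x + s - 1) = x `^ s * (t / x) `^ s * t `^ (x - 1).
  rewrite -powRM ?divr_ge0 ?(ltW t0) ?(ltW x0) // (mulrCA x) divff ?gt_eqF // mulr1.
  rewrite (_ : x + s - 1 = s + (x - 1)); last by ring.
  by rewrite powRD // (gt_eqF t0) implybT.
have -> : t `^ x = t * t `^ (x - 1) by rewrite mulr_powRB1 // ltW.
have := @powR_bernoulli R (t / x) s (divr_gt0 t0 x0) s01.
have : 0 <= x `^ s * t `^ (x - 1) * expR (- t).
  by rewrite !mulr_ge0 ?powR_ge0 ?expR_ge0.
move=> h1 h2; have := ler_wpM2l h1 h2.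
move: (x `^ s) (t `^ (x - 1)) ((t / x) `^ s) (expR (- t)) => a b c d h.
rewrite (_ : a * c * b * d = a * b * d * c); last by ring.
apply: (le_trans h); rewrite le_eqVlt; apply/orP; left.
by apply/eqP; field; rewrite gt_eqF.
Qed.

(** For arguments at least [1], Wendel's inequality starting from the integer part bounds the
    integral by a multiple of a factorial. The recurrence then covers the arguments below [1]. *)
Lemma gamma_integral_fin_num (R : realType) (x : R) : 0 < x ->
  gamma_integral x 1 \is a fin_num.
Proof.
have I0 (y : R) : (0 <= gamma_integral y (1 : R))%E.
  by apply: integral_ge0 => t _; rewrite lee_fin gamma_kernel_ge0.
have ge1 (y : R) : 1 <= y -> gamma_integral y 1 \is a fin_num.
  move=> y1; have y0 : 0 <= y by apply: le_trans y1.
  have /andP[ny yn] := truncn_itv y0.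
  have n0 : 0 < (Num.truncn y)%:R :> R by rewrite ltr0n truncn_gt0.
  move: n0 ny yn; rewrite ltr0n; case: (Num.truncn y) => // m _ my ym.
  have s01 : 0 <= y - m.+1%:R <= 1.
    by rewrite subr_ge0 my /= lerBlDl natr1 ltW.
  have := @gamma_integral_wendel R m.+1%:R (y - m.+1%:R) (ltr0Sn _ _) s01.
  rewrite addrC subrK gamma_integral_natS // -EFinM => h.
  by rewrite ge0_fin_numE // (le_lt_trans h) // ltry.
move=> x0.
have := @gamma_integralS R x 1 x0 ltr01; rewrite mul1e => h.
have := ge1 (x + 1); rewrite lerDr (ltW x0) => /(_ isT).
rewrite h => xfin.
rewrite (_ : gamma_integral x 1 = (x^-1)%:E * (x%:E * gamma_integral x 1))%E.
  by rewrite fin_numM.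
by rewrite muleA -EFinM mulVf ?gt_eqF // mul1e.
Qed.

Lemma EFin_Gamma (R : realType) (x : R) : 0 < x -> (Gamma x)%:E = gamma_integral x 1.
Proof.
move=> x0; rewrite /Gamma /Rintegral.
rewrite (_ : (\int[_]_(t in _) _)%E = gamma_integral x 1).
  by rewrite fineK // gamma_integral_fin_num.
by apply: eq_integral => t _; rewrite /gamma_kernel mul1r.
Qed.

Lemma GammaS (R : realType) (x : R) : 0 < x -> Gamma (x + 1) = x * Gamma x.
Proof.
move=> x0; apply: EFin_inj; rewrite EFinM !EFin_Gamma ?addr_gt0 //.
by rewrite -gamma_integralS // mul1e.
Qed.

Lemma Gamma_wendel (R : realType) (x s : R) : 0 < x -> 0 <= s <= 1 ->
  Gamma (x + s) <= x `^ s * Gamma x.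
Proof.
move=> x0 s01; have s0 : 0 <= s by case/andP: s01.
by rewrite -lee_fin EFinM !EFin_Gamma ?ltr_wpDr // gamma_integral_wendel.
Qed.

(** Wendel's inequality from [x] up to the next integer [n + 1] gives [n! <= x ^ s * Gamma x]. *)
Lemma Gamma_gt0 (R : realType) (x : R) : 0 < x -> 0 < Gamma x.
Proof.
move=> x0; have /andP[nx xn] := truncn_itv (ltW x0).
set n := Num.truncn x in nx xn.
have s01 : 0 <= n.+1%:R - x <= 1.
  by rewrite subr_ge0 (ltW xn) /= lerBlDl -natr1 lerD2r.
have h := Gamma_wendel x0 s01.
have : 0 < Gamma (n.+1%:R : R).
  rewrite -lte_fin EFin_Gamma // gamma_integral_natS // lte_fin.
  by rewrite expr1n divr1 ltr0n fact_gt0.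
rewrite addrC subrK in h => /lt_le_trans /(_ h).
by rewrite pmulr_rgt0 // powR_gt0.
Qed.

Lemma ln_Gamma_wendel (R : realType) (x s : R) : 0 < x -> 0 <= s <= 1 ->
  ln (Gamma (x + s)) - ln (Gamma x) <= s * ln x.
Proof.
move=> x0 s01; have s0 : 0 <= s by case/andP: s01.
rewrite -ln_powR lerBlDr -lnM ?posrE ?powR_gt0 ?Gamma_gt0 //.
by rewrite ler_ln ?posrE ?mulr_gt0 ?powR_gt0 ?Gamma_gt0 ?ltr_wpDr // Gamma_wendel.
Qed.

Lemma ln_GammaS (R : realType) (x : R) : 0 < x ->
  ln (Gamma (x + 1)) = ln x + ln (Gamma x).
Proof. by move=> x0; rewrite GammaS // lnM // posrE ?Gamma_gt0. Qed.

(** * Hurwitz zeta function *)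

Lemma exprn_bernoulli (R : realType) (z : R) (n : nat) : 0 <= z ->
  1 + n%:R * (z - 1) <= z ^+ n.
Proof.
move=> z0; elim: n => [|n IH]; first by rewrite mul0r addr0 expr0.
rewrite exprS (le_trans _ (ler_wpM2l z0 IH)) // -subr_ge0 -natr1.
rewrite (_ : _ - _ = n%:R * (z - 1) ^+ 2); last by ring.
by rewrite mulr_ge0 // sqr_ge0.
Qed.

(** The convex function [v^-j] lies above its tangent at [u]. This is Bernoulli's inequality for
    [(u / v)^(j+1)], multiplied by [v / u^(j+1)]. *)
Lemma exprVn_tangent (R : realType) (u v : R) (j : nat) : 0 < u -> 0 < v ->
  - j%:R * (v - u) * u ^- j.+1 <= v ^- j - u ^- j.
Proof.
move=> u0 v0.
have := @exprn_bernoulli R (u / v) j.+1 (ltW (divr_gt0 u0 v0)).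
have vj : 0 < v / u ^+ j.+1 by rewrite divr_gt0 // exprn_gt0.
move=> /(ler_wpM2l (ltW vj)); rewrite expr_div_n -natr1.
have -> : v / u ^+ j.+1 * (u ^+ j.+1 / v ^+ j.+1) = v ^- j.
  by rewrite [v ^+ j.+1]exprS; field; rewrite !expf_neq0 ?gt_eqF.
move=> h; rewrite lerBrDr (le_trans _ h) // le_eqVlt; apply/orP; left; apply/eqP.
by rewrite exprS; field; rewrite ?expf_neq0 ?gt_eqF.
Qed.

Definition hurwitz_term (R : realType) (j : nat) (x : R) (k : nat) : R :=
  (x + k%:R) ^- j.

Definition hurwitz_zeta (R : realType) (j : nat) (x : R) : R :=
  limn (series (hurwitz_term j x)).

Lemma hurwitz_term_gt0 (R : realType) (j : nat) (x : R) (k : nat) : 0 < x ->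
  0 < hurwitz_term j x k.
Proof. by move=> x0; rewrite invr_gt0 exprn_gt0 // ltr_wpDr. Qed.

Lemma hurwitz_term_tangent (R : realType) (j : nat) (x y : R) (k : nat) :
  0 < x -> 0 < y ->
  - j%:R * (y - x) * hurwitz_term j.+1 x k <= hurwitz_term j y k - hurwitz_term j x k.
Proof.
move=> x0 y0; have := @exprVn_tangent R (x + k%:R) (y + k%:R) j.
rewrite !ltr_wpDr // => /(_ isT isT); apply: le_trans.
by rewrite le_eqVlt; apply/orP; left; apply/eqP; rewrite /hurwitz_term; ring.
Qed.

(** The tangent inequality for [1 / v] bounds [(x + n + 1)^-2] by the telescoping difference
    [1 / (x + n) - 1 / (x + n + 1)]. *)
Lemma is_cvg_hurwitz2 (R : realType) (x : R) : 0 < x ->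
  cvgn (series (hurwitz_term 2 x)).
Proof.
move=> x0; apply: nondecreasing_is_cvgn.
  by apply: nondecreasing_series => k _ _; rewrite ltW ?hurwitz_term_gt0.
exists (x ^- 2 + x^-1) => _ [n _ <-].
have xk (k : nat) : 0 < x + k%:R by rewrite ltr_wpDr.
apply: (@le_trans _ _ (series (hurwitz_term 2 x) n.+1)).
  by rewrite seriesSr lerDl ltW ?hurwitz_term_gt0.
(* The subtracted term strengthens the bound enough for an induction on [n]. *)
apply: (@le_trans _ _ (x ^- 2 + x^-1 - (x + n%:R)^-1)); last first.
  by rewrite gerBl invr_ge0 ltW.
elim: n => [|n IH].
  by rewrite /series /= big_nat1 /hurwitz_term addr0 addrK.
have := exprVn_tangent 1 (xk n.+1) (xk n).
rewrite seriesSr /= /hurwitz_term !expr1.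
have -> : x + n%:R - (x + n.+1%:R) = -1 by rewrite -natr1; ring.
move: IH; rewrite -/(hurwitz_term 2 x) => IH h; lra.
Qed.

Lemma is_cvg_hurwitz (R : realType) (j : nat) (x : R) : 0 < x ->
  cvgn (series (hurwitz_term j.+2 x)).
Proof.
move=> x0; apply: (@series_le_cvg _ _ (x ^- j *: hurwitz_term 2 x)).
- by move=> n; rewrite ltW ?hurwitz_term_gt0.
- move=> n; change (0 <= x ^- j * hurwitz_term 2 x n).
  apply: mulr_ge0; last exact/ltW/hurwitz_term_gt0.
  by rewrite invr_ge0 exprn_ge0 // ltW.
- move=> n; change (hurwitz_term j.+2 x n <= x ^- j * hurwitz_term 2 x n).
  rewrite /hurwitz_term -addn2 exprD invfM.
  rewrite ler_wpM2r ?invr_ge0 ?exprn_ge0 ?addr_ge0 ?(ltW x0) //.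
  rewrite lef_pV2 ?posrE ?exprn_gt0 ?ltr_wpDr // lerXn2r ?nnegrE ?addr_ge0 ?(ltW x0) //.
  by rewrite lerDl.
- exact/is_cvg_seriesZ/is_cvg_hurwitz2.
Qed.

Lemma hurwitz_zeta_gt0 (R : realType) (j : nat) (x : R) : 0 < x ->
  0 < hurwitz_zeta j.+2 x.
Proof.
move=> x0; apply: (@lt_le_trans _ _ (hurwitz_term j.+2 x 0)).
  exact: hurwitz_term_gt0.
have <- : series (hurwitz_term j.+2 x) 1 = hurwitz_term j.+2 x 0.
  by rewrite /series /= big_nat1.
apply: nondecreasing_cvgn_le; last exact: is_cvg_hurwitz.
by apply: nondecreasing_series => k _ _; rewrite ltW ?hurwitz_term_gt0.
Qed.

(** The tangent inequality survives summation. Used at [x, y] and at [y, x], it bounds increments on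
    both sides, which replaces a theorem on termwise differentiation. *)
Lemma hurwitz_zeta_tangent (R : realType) (j : nat) (x y : R) : 0 < x -> 0 < y ->
  - j.+2%:R * (y - x) * hurwitz_zeta j.+3 x <= hurwitz_zeta j.+2 y - hurwitz_zeta j.+2 x.
Proof.
move=> x0 y0; have cx := @is_cvg_hurwitz R j x x0.
have cy := @is_cvg_hurwitz R j y y0.
have c3 := @is_cvg_hurwitz R j.+1 x x0.
have := lim_seriesZ (- j.+2%:R * (y - x)) c3; rewrite {2}/GRing.scale /= => E.
rewrite /hurwitz_zeta -(lim_seriesB cy cx) -E.
apply: lim_series_le; [exact: is_cvg_seriesZ|exact: is_cvg_seriesB|].
by move=> k; exact: hurwitz_term_tangent.
Qed.

(** The hypothesis is the subgradient inequality of a convex function at both points. Dividing by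
    [y - x], of either sign, puts the difference quotient between [g x] and [g y]. It serves for the
    Hurwitz zeta function, the digamma series and [ln Gamma]. *)
Lemma is_derive_sandwich (R : realType) (f g : R -> R) (x : R) :
  (\forall y \near x, (y - x) * g x <= f y - f x <= (y - x) * g y) ->
  {for x, continuous g} -> is_derive x 1 f (g x).
Proof.
move=> fg cg.
have shx : (h + x) @[h --> (0 : R)^'] --> x.
  have : (h + x) @[h --> (0 : R)^'] --> 0 + x.
    by apply: cvgD; [exact: cvg_within|exact: cvg_cst].
  by rewrite add0r.
have C : (fun h : R => h^-1 *: ((f \o shift x) (h *: (1 : R)) - f x)) @ (0 : R)^' --> g x.
  apply/cvgrPdist_le => e e0.
  have H1 : \forall h \near (0 : R)^', `|g x - g (h + x)| <= e.
    have : g (h + x) @[h --> (0 : R)^'] --> g x by apply: cvg_comp shx cg.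
    by move/cvgrPdist_le => /(_ e e0).
  have H2 : \forall h \near (0 : R)^',
      (h + x - x) * g x <= f (h + x) - f x <= (h + x - x) * g (h + x).
    exact: shx fg.
  near=> h.
  have hn0 : h != 0 by near: h; exact: nbhs_dnbhs_neq.
  have /andP[] : (h + x - x) * g x <= f (h + x) - f x <= (h + x - x) * g (h + x).
    by near: h.
  have : `|g x - g (h + x)| <= e by near: h.
  rewrite addrK /= /GRing.scale /= mulr1 => h1 h2 h3.
  apply: le_trans h1; set q := f _ - f x in h2 h3 *.
  have e1 : q = h * (h^-1 * q) by rewrite mulrA divff // mul1r.
  move: (h^-1 * q) e1 => r e1; rewrite e1 in h2 h3.
  have [hlt|hgt|h0] := ltrgtP h 0; last by rewrite h0 eqxx in hn0.
  - rewrite !ler_nM2l // in h2 h3.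
    by rewrite !ger0_norm ?subr_ge0 //; lra.
  - rewrite !ler_pM2l // in h2 h3.
    by rewrite !ler0_norm ?subr_le0 //; lra.
split; first by apply/cvg_ex; exists (g x).
exact: cvg_lim.
Unshelve. all: by end_near. Qed.

Lemma near_itvoy (R : realType) (a x : R) : a < x -> \forall y \near x, a < y.
Proof.
move=> ax; have xa : x \in `]a, +oo[ by rewrite in_itv /= ax.
have := near_in_itvoy xa; apply: filterS => y.
by rewrite in_itv /= andbT.
Qed.

Lemma hurwitz_zeta_nincr (R : realType) (j : nat) (x y : R) : 0 < x -> x <= y ->
  hurwitz_zeta j.+2 y <= hurwitz_zeta j.+2 x.
Proof.
move=> x0 xy; have y0 := lt_le_trans x0 xy.
have := hurwitz_zeta_tangent j y0 x0.
have : 0 <= - j.+2%:R * (x - y) * hurwitz_zeta j.+3 y.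
  by rewrite mulr_ge0 ?(ltW (hurwitz_zeta_gt0 _ y0)) // mulr_le0 ?oppr_le0 ?subr_le0.
by move=> h1 h2; rewrite -subr_ge0 (le_trans h1).
Qed.

(** Local Lipschitz bound: to the right of [x / 2] every tangent slope is at most [K] in absolute
    value, since [hurwitz_zeta j.+3] is nonincreasing. *)
Lemma continuous_hurwitz_zeta (R : realType) (j : nat) (x : R) : 0 < x ->
  {for x, continuous (hurwitz_zeta (R := R) j.+2)}.
Proof.
move=> x0; pose K := j.+2%:R * hurwitz_zeta j.+3 (x / 2).
have x20 : 0 < x / 2 by rewrite divr_gt0.
have K0 : 0 < K by rewrite mulr_gt0 ?hurwitz_zeta_gt0.
apply/cvgrPdist_le => e e0; near=> y.
have hy : x / 2 < y.
  by near: y; apply: near_itvoy; rewrite ltr_pdivrMr // ltr_pMr // ltr1n.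
have hx : x / 2 <= x by rewrite ler_pdivrMr // ler_peMr ?(ltW x0) // ler1n.
have hd : `|x - y| <= e / K.
  near: y; have := @cvg_id _ (nbhs x); move/cvgrPdist_le; apply.
  by rewrite divr_gt0.
have y0 := lt_trans x20 hy.
have B z : x / 2 <= z -> j.+2%:R * hurwitz_zeta j.+3 z <= K.
  by move=> h; rewrite ler_wpM2l // hurwitz_zeta_nincr.
have := hurwitz_zeta_tangent j x0 y0; have := hurwitz_zeta_tangent j y0 x0.
have Bx := B x hx; have By := B y (ltW hy).
have zx := hurwitz_zeta_gt0 j.+1 x0; have zy := hurwitz_zeta_gt0 j.+1 y0.
rewrite (_ : - _ * (x - y) * _ = (y - x) * (j.+2%:R * hurwitz_zeta j.+3 y)); last by ring.
rewrite (_ : - _ * (y - x) * _ = (x - y) * (j.+2%:R * hurwitz_zeta j.+3 x)); last by ring.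
have {zx} : 0 < j.+2%:R * hurwitz_zeta j.+3 x by rewrite mulr_gt0.
have {zy} : 0 < j.+2%:R * hurwitz_zeta j.+3 y by rewrite mulr_gt0.
move: (j.+2%:R * hurwitz_zeta j.+3 x) (j.+2%:R * hurwitz_zeta j.+3 y) Bx By => a b.
move=> aK bK b0 a0 h1 h2; rewrite ler_pdivlMr // in hd.
apply: le_trans hd; rewrite distrC (distrC x y).
have N c : 0 < c -> c <= K -> `|(y - x) * c| <= `|y - x| * K.
  by move=> c0 cK; rewrite normrM (gtr0_norm c0) ler_wpM2l.
have := N _ a0 aK; have := N _ b0 bK; rewrite !ler_norml.
by move=> /andP[h3 h4] /andP[h5 h6]; apply/andP; split; lra.
Unshelve. all: by end_near. Qed.

Lemma is_derive_hurwitz_zeta (R : realType) (j : nat) (x : R) : 0 < x ->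
  is_derive x 1 (hurwitz_zeta (R := R) j.+2) (- j.+2%:R * hurwitz_zeta j.+3 x).
Proof.
move=> x0.
apply: (@is_derive_sandwich _ _ (fun y => - j.+2%:R * hurwitz_zeta j.+3 y)).
  near=> y; have y0 : 0 < y by near: y; exact: near_itvoy.
  have := hurwitz_zeta_tangent j x0 y0; have := hurwitz_zeta_tangent j y0 x0.
  by move=> h1 h2; apply/andP; split; lra.
by apply: cvgM; [exact: cvg_cst|exact: continuous_hurwitz_zeta].
Unshelve. all: by end_near. Qed.

(** * The series of the digamma function *)

Definition digamma_term (R : realType) (x : R) (k : nat) : R :=
  ln k.+2%:R - ln k.+1%:R - (x + k%:R)^-1.

(** The logarithms telescope, so this is the limit of [ln (n + 1)] minus the sum of [1 / (x + k)]
    for [k < n]; Euler's constant does not appear. *)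
Definition digamma_sum (R : realType) (x : R) : R := limn (series (digamma_term x)).

Lemma ln_sub_bounds (R : realType) (u v : R) : 0 < u -> 0 < v ->
  (v - u) / v <= ln v - ln u <= (v - u) / u.
Proof.
move=> u0 v0.
have B (a b : R) : 0 < a -> 0 < b -> ln b - ln a <= (b - a) / a.
  move=> a0 b0; rewrite -ln_div ?posrE //.
  have := @le_ln1Dx R (b / a - 1); rewrite (addrC 1) subrK ltrBrDr addNr divr_gt0 //.
  by move=> /(_ isT); rewrite mulrBl divff // gt_eqF.
rewrite B // andbT; have := B v u v0 u0.
have -> : (u - v) / v = - ((v - u) / v) by ring.
by move=> h; lra.
Qed.

Lemma is_cvg_digamma_sum (R : realType) (x : R) : 0 < x ->
  cvgn (series (digamma_term x)).
Proof.
(* In [c], the part [|x - 1|] pays for replacing [1 / (x + k)] by [1 / (k + 1)], and the part [1]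
   for replacing the difference of logarithms by [1 / (k + 1)]. *)
move=> x0; apply: normed_cvg; pose c := `|x - 1| + 1.
apply: (@series_le_cvg _ _ (c *: (hurwitz_term 2 x + hurwitz_term 2 1))).
- by move=> n; exact: normr_ge0.
- move=> n; change (0 <= c * (hurwitz_term 2 x n + hurwitz_term 2 1 n)).
  by rewrite mulr_ge0 ?addr_ge0 // ltW ?hurwitz_term_gt0.
- move=> n; change (`|digamma_term x n| <= c * (hurwitz_term 2 x n + hurwitz_term 2 1 n)).
  have h1 := hurwitz_term_tangent 1 n x0 ltr01.
  have h2 := hurwitz_term_tangent 1 n ltr01 x0.
  have := hurwitz_term_gt0 2 n x0; have := @hurwitz_term_gt0 R 2 1 n ltr01.
  have := @ln_sub_bounds R n.+1%:R n.+2%:R (ltr0Sn _ _) (ltr0Sn _ _).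
  have -> : n.+2%:R - n.+1%:R = 1 :> R by rewrite -[n.+2%:R]natr1; ring.
  have : n.+1%:R^-1 - n.+2%:R^-1 <= hurwitz_term 2 1 n :> R.
    have := @exprVn_tangent R n.+1%:R n.+2%:R 1 (ltr0Sn _ _) (ltr0Sn _ _).
    rewrite /hurwitz_term (addrC 1) natr1 !expr1.
    have -> : n.+2%:R - n.+1%:R = 1 :> R by rewrite -[n.+2%:R]natr1; ring.
    by rewrite mulr1 mulN1r lerNl opprB.
  have e1 : hurwitz_term 1 1 n = n.+1%:R^-1 :> R.
    by rewrite /hurwitz_term expr1 addrC natr1.
  have e2 : digamma_term x n = ln n.+2%:R - ln n.+1%:R - hurwitz_term 1 x n.
    by rewrite /hurwitz_term expr1.
  rewrite e2 !div1r {}/c; rewrite e1 in h1 h2.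
  move: (hurwitz_term 2 x n) (hurwitz_term 2 1 n) h1 h2 => a b h1 h2 h3 /andP[h4 h5] b0 a0.
  have := ler_norm ((1 - x) * a); have := ler_norm (- ((1 - x) * a)).
  have := ler_norm ((1 - x) * b); have := ler_norm (- ((1 - x) * b)).
  move: (n.+1%:R^-1) (n.+2%:R^-1) (ln n.+1%:R) (ln n.+2%:R) (hurwitz_term 1 x n) h1 h2 h3 h4 h5.
  move=> p q l1 l2 t h1 h2 h3 h4 h5.
  rewrite !normrN !normrM (gtr0_norm a0) (gtr0_norm b0) (distrC 1 x).
  move=> h6 h7 h8 h9; rewrite ler_norml; apply/andP. split; lra.
- by apply: is_cvg_seriesZ; apply: is_cvg_seriesD; exact: is_cvg_hurwitz2.
Qed.

Lemma digamma_sum_tangent (R : realType) (x y : R) : 0 < x -> 0 < y ->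
  digamma_sum y - digamma_sum x <= (y - x) * hurwitz_zeta 2 x.
Proof.
move=> x0 y0; have cx := is_cvg_digamma_sum x0; have cy := is_cvg_digamma_sum y0.
have c2 := is_cvg_hurwitz2 x0.
have := lim_seriesZ (y - x) c2; rewrite {2}/GRing.scale /= => E.
rewrite /digamma_sum /hurwitz_zeta -(lim_seriesB cy cx) -E.
apply: lim_series_le; [exact: is_cvg_seriesB|exact: is_cvg_seriesZ|].
move=> k; change (digamma_term y k - digamma_term x k <= (y - x) * hurwitz_term 2 x k).
have := hurwitz_term_tangent 1 k x0 y0; rewrite /digamma_term /hurwitz_term !expr1.
by move: (_ ^- 2) => a h; lra.
Qed.

Lemma is_derive_digamma_sum (R : realType) (x : R) : 0 < x ->
  is_derive x 1 (digamma_sum (R := R)) (hurwitz_zeta 2 x).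
Proof.
(* The digamma series is concave, whereas the sandwich is stated for the convex case, hence the
   change of sign. *)
move=> x0; rewrite -[hurwitz_zeta 2 x]opprK -[digamma_sum (R := R)]opprK.
apply: is_deriveN.
apply: (@is_derive_sandwich _ _ (fun y => - hurwitz_zeta 2 y)).
  near=> y; have y0 : 0 < y by near: y; exact: near_itvoy.
  have := digamma_sum_tangent x0 y0; have := digamma_sum_tangent y0 x0.
  rewrite !fctE; move=> h1 h2; apply/andP; split; lra.
by apply: cvgN; exact: continuous_hurwitz_zeta.
Unshelve. all: by end_near. Qed.

(** * Digamma and polygamma functions *)

Lemma series_digamma_term (R : realType) (x : R) (n : nat) :
  series (digamma_term x) n = ln n.+1%:R - \sum_(0 <= k < n) (x + k%:R)^-1.
Proof.
elim: n => [|n IH]; first by rewrite /series /= !big_nil ln1 subr0.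
by rewrite seriesSr IH big_nat_recr //= /digamma_term; ring.
Qed.

Lemma cvg_inv_addn (R : realType) (z : R) : 0 < z ->
  (z + n%:R)^-1 @[n --> \oo] --> (0 : R).
Proof.
move=> z0; apply: (@squeeze_cvgr _ _ _ _ (fun=> 0) (fun n => (Num.max 1 z^-1) * n.+1%:R^-1)).
- near=> n; rewrite invr_ge0 addr_ge0 ?(ltW z0) //=.
  rewrite -[leRHS]invrK lef_pV2 ?posrE ?ltr_wpDr ?invr_gt0 ?mulr_gt0 ?invr_gt0 ?lt_max ?ltr01 //.
  rewrite invfM invrK -natr1 mulrDr mulr1 addrC lerD //.
    rewrite -[leRHS]invrK lef_pV2 ?posrE ?invr_gt0 ?lt_max ?ltr01 //.
    by rewrite le_max lexx orbT.
  by rewrite ler_piMl // invf_le1 ?lt_max ?ltr01 // le_max lexx.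
- exact: cvg_cst.
- rewrite -(mulr0 (Num.max 1 z^-1)); apply: cvgM; [exact: cvg_cst|].
  exact: cvg_harmonic.
Unshelve. all: by end_near. Qed.

(** The reverse bound is Wendel's inequality itself, taken from [x + s] up to [x + 1] and combined
    with the recurrence. Here [L] stands for [ln Gamma]. *)
Lemma wendel_ge (R : realType) (L : R -> R)
    (LS : forall x, 0 < x -> L (x + 1) = ln x + L x)
    (Lle : forall x s, 0 < x -> 0 <= s <= 1 -> L (x + s) - L x <= s * ln x)
    (x s : R) : 0 < x -> 0 <= s <= 1 ->
  ln x - (1 - s) * ln (x + s) <= L (x + s) - L x.
Proof.
move=> x0 /andP[s0 s1].
have xs0 : 0 < x + s by rewrite ltr_wpDr.
have := Lle _ (1 - s) xs0.
rewrite subr_ge0 s1 lerBlDl lerDr s0 => /(_ isT).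
by rewrite -addrA (addrC s) subrK LS //; lra.
Qed.

Lemma wendel_addn (R : realType) (L : R -> R)
    (LS : forall x, 0 < x -> L (x + 1) = ln x + L x) (x : R) (n : nat) : 0 < x ->
  L (x + n%:R) = L x + \sum_(0 <= k < n) ln (x + k%:R).
Proof.
move=> x0; elim: n => [|n IH]; first by rewrite big_nil !addr0.
rewrite big_nat_recr //= -natr1 addrA LS ?ltr_wpDr // IH.
ring.
Qed.

(* Wendel's inequality forces [L (x + n + s) - L (x + n)] to be asymptotic to
   [s ln n], which leaves a telescoping sum of logarithms. *)
Lemma wendel_sandwich (R : realType) (L : R -> R)
    (LS : forall x, 0 < x -> L (x + 1) = ln x + L x)
    (Lle : forall x s, 0 < x -> 0 <= s <= 1 -> L (x + s) - L x <= s * ln x)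
    (x s : R) : 0 < x -> 0 <= s <= 1 ->
  s * digamma_sum x <= L (x + s) - L x <= s * digamma_sum (x + s).
Proof.
move=> x0 s01; have /andP[s0 s1] := s01; have y0 : 0 < x + s by rewrite ltr_wpDr.
set D := L (x + s) - _.
have Dn (n : nat) : D = (L (x + n%:R + s) - L (x + n%:R)) -
    \sum_(0 <= k < n) (ln (x + s + k%:R) - ln (x + k%:R)).
  by rewrite sumrB /D (_ : x + n%:R + s = x + s + n%:R) ?(wendel_addn LS) //; ring.
have xn (n : nat) : 0 < x + n%:R by rewrite ltr_wpDr.
have yn (n : nat) : 0 < x + s + n%:R by rewrite ltr_wpDr.
have e (n : nat) : x + s + n%:R - (x + n%:R) = s by ring.
have cD (z : R) : 0 < z -> series (digamma_term z) n @[n --> \oo] --> digamma_sum z.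
  exact: is_cvg_digamma_sum.
apply/andP; split.
(* The last two summands tend to [0]. They are the costs of replacing [ln (x + n)] by
   [ln (x + s + n)], and then [s * ln (x + s + n)] by [s * ln (n + 1)]. *)
- apply: (@cvgr_to_le _ \oo _ _ (fun n => s * series (digamma_term x) n -
    s * (x + n%:R)^-1 + s * (x + s - 1) * (x + s + n%:R)^-1)).
    rewrite -[X in _ --> X]addr0 -(mulr0 (s * (x + s - 1))); apply: cvgD; last first.
      by apply: cvgM; [exact: cvg_cst|exact: cvg_inv_addn].
    rewrite -[X in _ --> X]subr0 -[in X in _ --> _ - X](mulr0 s); apply: cvgB.
      by apply: cvgM; [exact: cvg_cst|exact: cD].
    by apply: cvgM; [exact: cvg_cst|exact: cvg_inv_addn].
  near=> n; rewrite (Dn n) series_digamma_term.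
  have h1 := wendel_ge LS Lle (xn n) s01.
  have h2 : \sum_(0 <= k < n) (ln (x + s + k%:R) - ln (x + k%:R)) <=
      s * \sum_(0 <= k < n) (x + k%:R)^-1.
    rewrite mulr_sumr; apply: ler_sum => k _.
    by have /andP[_] := ln_sub_bounds (xn k) (yn k); rewrite e.
  have /andP[_] := ln_sub_bounds (xn n) (yn n); rewrite e => h3.
  have /andP[h4 _] := @ln_sub_bounds R n.+1%:R (x + s + n%:R) (ltr0Sn _ _) (yn n).
  have := ler_wpM2l s0 h4.
  rewrite -natr1 (_ : x + s + n%:R - _ = x + s - 1) => [h5|]; last by ring.
  rewrite (_ : x + n%:R + s = x + s + n%:R) in h1 *; last by ring.
  lra.
- apply: (@cvgr_to_ge _ \oo _ _ (fun n => s * series (digamma_term (x + s)) n +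
    s * (x - 1) * n.+1%:R^-1)).
    rewrite -[X in _ --> X]addr0 -(mulr0 (s * (x - 1))); apply: cvgD; last first.
      by apply: cvgM; [exact: cvg_cst|exact: cvg_harmonic].
    by apply: cvgM; [exact: cvg_cst|exact: cD].
  near=> n; rewrite (Dn n) series_digamma_term.
  have h1 := Lle _ _ (xn n) s01.
  have h2 : s * \sum_(0 <= k < n) (x + s + k%:R)^-1 <=
      \sum_(0 <= k < n) (ln (x + s + k%:R) - ln (x + k%:R)).
    rewrite mulr_sumr; apply: ler_sum => k _.
    by have /andP[+ _] := ln_sub_bounds (xn k) (yn k); rewrite e.
  have /andP[_ h4] := @ln_sub_bounds R n.+1%:R (x + n%:R) (ltr0Sn _ _) (xn n).
  have := ler_wpM2l s0 h4.
  rewrite -natr1 (_ : x + n%:R - _ = x - 1) => [h5|]; last by ring.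
  lra.
Unshelve. all: by end_near. Qed.

(** For [|x - y| <= 1] the Wendel sandwich, based at the smaller of the two points, is the
    hypothesis of [is_derive_sandwich] with [g] the digamma series. *)
Lemma is_derive_ln_Gamma (R : realType) (x : R) : 0 < x ->
  is_derive x 1 (fun y => ln (Gamma y)) (digamma_sum x).
Proof.
move=> x0; set L : R -> R := fun y => ln (Gamma y).
have W (y s : R) : 0 < y -> 0 <= s <= 1 ->
    s * digamma_sum y <= L (y + s) - L y <= s * digamma_sum (y + s).
  exact: (@wendel_sandwich R L (@ln_GammaS R) (@ln_Gamma_wendel R)).
move: L W => L W.
apply: (@is_derive_sandwich _ _ (@digamma_sum R)); last first.
  apply/differentiable_continuous/derivable1_diffP.
  by have [] := is_derive_digamma_sum x0.
near=> y; have y0 : 0 < y by near: y; exact: near_itvoy.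
have y1 : `|x - y| <= 1.
  by near: y; have := @cvg_id _ (nbhs x); move/cvgrPdist_le; apply.
have [xy|yx] := lerP x y.
  have s01 : 0 <= y - x <= 1.
    by move: y1; rewrite distrC ger0_norm subr_ge0 // => ->; rewrite xy.
  by have := W x _ x0 s01; rewrite (addrC x) subrK.
have s01 : 0 <= x - y <= 1.
  by move: y1; rewrite ger0_norm subr_ge0 ?(ltW yx) // => ->.
have := W y _ y0 s01; rewrite (addrC y) subrK => /andP[h1 h2].
by apply/andP; split; lra.
Unshelve. all: by end_near. Qed.

(** Near a positive point [Gamma] is the exponential of [ln Gamma], so the chain rule yields its
    derivative without differentiating under the integral. *)
Lemma digammaE (R : realType) (x : R) : 0 < x -> digamma x = digamma_sum x.
Proof.
move=> x0; rewrite /digamma derive1E.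
suff [_ ->] : is_derive x 1 (@Gamma R) (Gamma x * digamma_sum x).
  by rewrite mulrC mulKf // gt_eqF // Gamma_gt0.
have h := @is_derive1_comp _ expR (fun y => ln (Gamma y)) x _ _
  (is_derive_expR _) (is_derive_ln_Gamma x0).
rewrite [expR _]lnK ?posrE ?Gamma_gt0 // in h.
apply: near_eq_is_derive h; near=> y.
rewrite /= lnK // posrE Gamma_gt0 //.
by near: y; exact: near_itvoy.
Unshelve. all: by end_near. Qed.

Lemma derive1_near_eq (R : realType) (f g : R -> R) (x d : R) :
  (\forall y \near x, f y = g y) -> is_derive x 1 g d -> f^`()%classic x = d.
Proof.
move=> fg [_ <-]; rewrite derive1E; exact: near_eq_derive.
Qed.

Lemma polygammaS (R : realType) (k : nat) (x : R) : 0 < x ->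
  polygamma k.+1 x = (-1) ^+ k * (k.+1)`!%:R * hurwitz_zeta k.+2 x.
Proof.
elim: k x => [|k IH] x x0.
  rewrite /polygamma /= expr0 !mul1r.
  apply: derive1_near_eq (is_derive_digamma_sum x0).
  by near=> y; apply: digammaE; near: y; exact: near_itvoy.
rewrite /polygamma derive1nS.
have d := is_deriveZ ((-1) ^+ k * (k.+1)`!%:R) (is_derive_hurwitz_zeta k x0).
rewrite (derive1_near_eq _ d).
  by rewrite /GRing.scale /= [in RHS]factS natrM exprS; ring.
by near=> y; rewrite -/(polygamma k.+1 y) IH //; near: y; exact: near_itvoy.
Unshelve. all: by end_near. Qed.

Lemma normr_polygamma (R : realType) (k : nat) (x : R) : 0 < x ->
  `|polygamma k.+1 x| = (k.+1)`!%:R * hurwitz_zeta k.+2 x.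
Proof.
move=> x0; rewrite polygammaS // !normrM normrX normrN normr1 expr1n mul1r.
by rewrite !ger0_norm // ltW // hurwitz_zeta_gt0.
Qed.

(** * Complete monotonicity *)

(** [F k] stands for the [k]-th derivative of [f] times [(-1)^k]. Agreement on the open half-line
    suffices because derivatives are local. *)
Lemma completely_monotonic_iterated (R : realType) (f : R -> R) (F : nat -> R -> R) :
  (forall x, 0 < x -> f x = F 0%N x) ->
  (forall k (x : R), 0 < x -> is_derive x 1 (F k) (- F k.+1 x)) ->
  (forall k x, 0 < x -> 0 <= F k x) ->
  completely_monotonic `]0, +oo[ f.
Proof.
move=> fF dF F0.
have E k : forall x, 0 < x -> f^`(k)%classic x = (-1) ^+ k * F k x.
  elim: k => [|k IH] x x0; first by rewrite derive1n0 mul1r fF.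
  rewrite derive1nS; have d := is_deriveZ ((-1) ^+ k) (dF k x x0).
  rewrite (derive1_near_eq _ d) ?exprS; first by rewrite /GRing.scale /=; ring.
  by near=> y; apply: IH; near: y; exact: near_itvoy.
move=> k x; rewrite /= in_itv /= andbT => x0; split; last first.
  by rewrite E // mulrA -exprMn mulrNN mulr1 expr1n mul1r F0.
have d := is_deriveZ ((-1) ^+ k) (dF k x x0).
have [] // : is_derive x 1 f^`(k)%classic ((-1) ^+ k *: - F k.+1 x).
apply: near_eq_is_derive d; near=> y; rewrite [RHS]E //.
by near: y; exact: near_itvoy.
Unshelve. all: by end_near. Qed.

(* Differentiating [x * F 0 x = G 0 x] repeatedly gives
   [x * F k.+1 x = k.+1 * F k x + G k.+1 x] for [F k] and [G k] the [k]-th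
   derivatives up to the sign [(-1) ^+ k]. *)
Fixpoint iterated_div_id (R : realType) (G : nat -> R -> R) (k : nat) (x : R) : R :=
  if k is k'.+1 then (k%:R * iterated_div_id G k' x + G k x) / x else G 0%N x / x.

(** Division by [x] preserves complete monotonicity: the recursion of [iterated_div_id] has only
    nonnegative coefficients, so signs propagate by induction. *)
Lemma completely_monotonic_div_id (R : realType) (f : R -> R) (G : nat -> R -> R) :
  (forall x, 0 < x -> f x = G 0%N x / x) ->
  (forall k (x : R), 0 < x -> is_derive x 1 (G k) (- G k.+1 x)) ->
  (forall k x, 0 < x -> 0 <= G k x) ->
  completely_monotonic `]0, +oo[ f.
Proof.
move=> fG dG G0; apply: (@completely_monotonic_iterated _ _ (iterated_div_id G)) => //.
  have dinv (x : R) : 0 < x -> is_derive x 1 (fun y => y^-1) (- x ^- 2).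
    move=> x0; have := @is_deriveV _ id x 1 1 (lt0r_neq0 x0) (is_derive_id x 1).
    by rewrite /GRing.scale /= mulr1.
  elim=> [|k IH] x x0.
    apply: is_derive_eq; first exact: is_deriveM (dG 0%N x x0) (dinv x x0).
    by rewrite /GRing.scale /=; field; rewrite gt_eqF.
  apply: is_derive_eq.
    apply: is_deriveM (dinv x x0).
    exact: is_deriveD (is_deriveZ k.+1%:R (IH x x0)) (dG k.+1 x x0).
  rewrite /GRing.scale /=.
  rewrite -/(iterated_div_id G k x) -[k.+2%:R]natr1; by field; rewrite gt_eqF.
elim=> [|k IH] x x0 /=; first by rewrite divr_ge0 ?G0 // ltW.
by rewrite divr_ge0 ?(ltW x0) // addr_ge0 ?G0 // mulr_ge0 // IH.
Qed.

(** For [m >= 1] and [x > 0] this is the absolute value of the [m]-th polygamma function, in a form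
    that can be differentiated directly. *)
Definition polygamma_abs (R : realType) (m : nat) (x : R) : R :=
  m`!%:R * hurwitz_zeta m.+1 x.

Lemma is_derive_polygamma_abs (R : realType) (m : nat) (b x : R) : 0 < x + b ->
  is_derive x 1 (fun y : R => polygamma_abs m.+1 (y + b)) (- polygamma_abs m.+2 (x + b)).
Proof.
move=> xb0.
have d := is_deriveZ (m.+1)`!%:R (is_derive_hurwitz_zeta m xb0).
have s : is_derive x 1 (fun y : R => y + b) 1 by exact: is_derive_shift.
have := @is_derive1_comp _ (polygamma_abs m.+1) (fun y => y + b) x _ _ d s.
rewrite mulr1 /GRing.scale /=; congr is_derive.
by rewrite /polygamma_abs [in RHS]factS natrM; ring.
Qed.

(** The sign [e] is [1] or [-1] according to the order of the difference. On differentiation, the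
    product rule on [x * polygamma_abs] yields the one extra term that raises [a + k] to
    [a + k + 1]. *)
Definition ratio_family (R : realType) (i : nat) (e a b : R) (k : nat) (x : R) : R :=
  e * ((a + k%:R) * polygamma_abs (i + k) (x + b) - x * polygamma_abs (i + k).+1 (x + b)).

Lemma completely_monotonic_ratio (R : realType) (i : nat) (e a b : R) (f : R -> R) :
  (1 <= i)%N -> 0 <= b ->
  (forall x, 0 < x -> f x =
    e * (a / x * `|polygamma i (x + b)| - `|polygamma i.+1 (x + b)|)) ->
  (forall k x, 0 < x -> 0 <= ratio_family i e a b k x) ->
  completely_monotonic `]0, +oo[ f.
Proof.
case: i => // i _ b0 fE; apply: completely_monotonic_div_id => [x x0|k x x0].
  have xb0 : 0 < x + b by rewrite ltr_wpDr.
  rewrite fE // !normr_polygamma // /ratio_family /polygamma_abs !addn0 addr0.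
  by field; rewrite gt_eqF.
have xb0 : 0 < x + b by rewrite ltr_wpDr.
have dP := is_derive_polygamma_abs (i + k) xb0.
have dQ := is_derive_polygamma_abs (i + k).+1 xb0.
have d := is_deriveZ e (is_deriveB (is_deriveZ (a + k%:R) dP)
  (is_deriveM (is_derive_id x (1 : R)) dQ)).
apply: (@is_derive_eq _ _ _ (ratio_family i.+1 e a b k) x 1 _ _ d).
rewrite /ratio_family !addnS !addSn /GRing.scale /= -natr1.
by ring.
Qed.

(** * Comparison of Hurwitz zeta values by Laplace transforms *)

Lemma nneseries_EFin (R : realType) (u : nat -> R) (l : R) :
  series u n @[n --> \oo] --> l -> (\sum_(n <oo) (u n)%:E = l%:E)%E.
Proof.
move=> ul; apply/cvg_lim => //.
have -> : (fun n => \sum_(0 <= k < n) (u k)%:E)%E = (fun n => (series u n)%:E).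
  by apply/funext => n; rewrite sumEFin.
by apply: cvg_EFin => //; near=> n.
Unshelve. all: by end_near. Qed.

Lemma series_affine_geometric (R : realType) (b t : R) : 0 < t ->
  series (fun n => (n%:R + b) * expR (- t) ^+ n) n @[n --> \oo] -->
  ((expR t - 1)^-1 + b) / (1 - expR (- t)).
Proof.
move=> t0; set z := expR (- t).
have z0 : 0 < z by exact: expR_gt0.
have z1 : z < 1 by rewrite expR_lt1 oppr_lt0.
have zn : 1 - z != 0 by rewrite gt_eqF // subr_gt0.
have -> : (expR t - 1)^-1 = z / (1 - z).
  have -> : expR t = z^-1 by rewrite /z expRN invrK.
  by field; rewrite zn gt_eqF //= gt_eqF // subr_gt0 invf_gt1.
have w0 : (n.+2%:R : R) * z ^+ n.+2 @[n --> \oo] --> (0 : R).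
  have := @powR_expR_cvg0 R 1 t t0; apply: cvg_trans.
  apply: near_eq_cvg; near=> n.
  by rewrite powRr1 // -expRM_natl /z; congr (_ * expR _); ring.
have v0 : z ^+ n @[n --> \oo] --> (0 : R).
  by apply: cvg_expr; rewrite gtr0_norm.
(* Closed form of the partial sums of an arithmetico-geometric series; the limit then only involves
   [n * z^n] and [z^n]. *)
have S (n : nat) : series (fun n => (n%:R + b) * z ^+ n) n =
    (z - n%:R * z ^+ n + (n%:R - 1) * z ^+ n.+1) / (1 - z) ^+ 2 +
    b * (1 - z ^+ n) / (1 - z).
  elim: n => [|n IH]; first by rewrite /series /= big_nil expr0 expr1; field.
  by rewrite seriesSr IH !exprS -natr1; field.
(* The shift matches [powR_expR_cvg0], which is stated along [n + 2]. *)
rewrite -(cvg_shiftn 2).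
have -> : (fun n => series (fun n => (n%:R + b) * z ^+ n) (n + 2)%N) =
   (fun n => (z + (z - 1) * (n.+2%:R * z ^+ n.+2) - z ^+ 3 * z ^+ n) / (1 - z) ^+ 2 +
     b * (1 - z ^+ 2 * z ^+ n) / (1 - z)).
  by apply/funext => n; rewrite S addn2 !exprS; congr (_ + _); field.
have -> : (z / (1 - z) + b) / (1 - z) =
   (z + (z - 1) * 0 - z ^+ 3 * 0) / (1 - z) ^+ 2 + b * (1 - z ^+ 2 * 0) / (1 - z).
  by field.
have C (c : R) : c @[n --> \oo] --> c by exact: cvg_cst.
apply: cvgD.
  apply: cvgM => //; apply: cvgB; last exact: cvgM.
  by apply: cvgD => //; apply: cvgM.
by do 2!apply: cvgM => //; apply: cvgB => //; apply: cvgM.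
Unshelve. all: by end_near. Qed.

Definition laplace_series (R : realType) (a : nat -> R) (m : nat) (y t : R) : \bar R :=
  (\sum_(n <oo) (a n * gamma_kernel m.+1%:R (y + n%:R) t)%:E)%E.

(** Nonnegative coefficients allow the exchange of sum and integral in the extended reals; each term
    is then a Gamma integral at an integer. *)
Lemma integral_laplace_series (R : realType) (a : nat -> R) (m : nat) (y : R) :
  (forall n, 0 <= a n) -> 0 < y ->
  (\int[lebesgue_measure]_(t in `]0%R, +oo[) laplace_series a m y t =
   \sum_(n <oo) (a n * m`!%:R * hurwitz_term m.+1 y n)%:E)%E.
Proof.
move=> a0 y0; rewrite /laplace_series integral_nneseries //=.
- apply: eq_eseriesr => n _.
  have yn : 0 < y + n%:R by rewrite ltr_wpDr.
  under eq_integral do rewrite EFinM.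
  rewrite ge0_integralZl_EFin //; last 2 first.
  - by move=> t _; rewrite lee_fin gamma_kernel_ge0.
  - exact: measurable_gamma_kernel.
  by rewrite -/(gamma_integral _ _) gamma_integral_natS // -EFinM mulrA.
- move=> n; apply/measurable_EFinP; apply: measurable_funM => //.
  by apply/measurable_EFinP; exact: measurable_gamma_kernel.
- by move=> n t _; rewrite lee_fin mulr_ge0 // gamma_kernel_ge0.
Qed.

Lemma laplace_series_le (R : realType) (a1 a2 : nat -> R) (m1 m2 : nat) (y : R) :
  (forall n, 0 <= a1 n) -> (forall n, 0 <= a2 n) -> 0 < y ->
  (forall t : R, (0 < t)%R -> laplace_series a1 m1 y t <= laplace_series a2 m2 y t)%E ->
  (\sum_(n <oo) (a1 n * m1`!%:R * hurwitz_term m1.+1 y n)%:E <=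
   \sum_(n <oo) (a2 n * m2`!%:R * hurwitz_term m2.+1 y n)%:E)%E.
Proof.
move=> a10 a20 y0 h.
rewrite -(integral_laplace_series m1 a10 y0) -(integral_laplace_series m2 a20 y0).
have k0 (a : nat -> R) (m n : nat) (t : R) : (forall n, 0 <= a n) ->
    (0 <= (a n * gamma_kernel m.+1%:R (y + n%:R) t)%:E)%E.
  by move=> an; rewrite lee_fin mulr_ge0 // gamma_kernel_ge0.
have ml (a : nat -> R) (m : nat) (D : set R) : (forall n, 0 <= a n) ->
    measurable_fun D (laplace_series a m y).
  move=> an; apply: ge0_emeasurable_sum => n.
    by move=> t _ _; exact: k0.
  move=> _; apply/measurable_EFinP; apply: measurable_funM => //.
  by apply/measurable_EFinP; exact: measurable_gamma_kernel.
apply: ge0_le_integral => //.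
- by move=> t _; apply: nneseries_ge0 => n _ _; exact: k0.
- exact: ml.
- exact: ml.
- by move=> t /=; rewrite in_itv /= andbT => /h.
Qed.

Lemma gamma_kernel_natS (R : realType) (m n : nat) (y t : R) : 0 < t ->
  gamma_kernel m.+1%:R (y + n%:R) t = t ^+ m * expR (- (y * t)) * expR (- t) ^+ n.
Proof.
move=> t0; rewrite /gamma_kernel -natr1 addrK powR_mulrn ?(ltW t0) //.
rewrite -expRM_natl -[RHS]mulrA -expRD; congr (_ * expR _).
by rewrite mulrDl opprD mulrN.
Qed.

Lemma laplace_series_cst (R : realType) (c : R) (m : nat) (y t : R) : 0 < t ->
  laplace_series (fun=> c) m y t =
  (t ^+ m * expR (- (y * t)) * (c / (1 - expR (- t))))%:E.
Proof.
move=> t0; apply: nneseries_EFin.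
have -> : (fun n => c * gamma_kernel m.+1%:R (y + n%:R) t) =
    (t ^+ m * expR (- (y * t))) *: geometric c (expR (- t)).
  apply/funext => n; rewrite gamma_kernel_natS //.
  exact: mulrCA.
have g : series (geometric c (expR (- t))) n @[n --> \oo] --> c / (1 - expR (- t)).
  by apply: cvg_geometric_series; rewrite gtr0_norm ?expR_gt0 // expR_lt1 oppr_lt0.
rewrite seriesZ; apply: cvgM => //; exact: cvg_cst.
Qed.

Lemma laplace_series_affine (R : realType) (b : R) (m : nat) (y t : R) : 0 < t ->
  laplace_series (fun n => n%:R + b) m y t =
  (t ^+ m * expR (- (y * t)) * (((expR t - 1)^-1 + b) / (1 - expR (- t))))%:E.
Proof.
move=> t0; apply: nneseries_EFin.
have -> : (fun n => (n%:R + b) * gamma_kernel m.+1%:R (y + n%:R) t) =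
    (t ^+ m * expR (- (y * t))) *: (fun n => (n%:R + b) * expR (- t) ^+ n).
  by apply/funext => n; rewrite gamma_kernel_natS //; exact: mulrCA.
rewrite seriesZ; apply: cvgM; [exact: cvg_cst|exact: series_affine_geometric].
Qed.

Lemma hurwitz_nneseries_cst (R : realType) (c d : R) (j : nat) (y : R) : 0 < y ->
  (\sum_(n <oo) (c * d * hurwitz_term j.+2 y n)%:E = (c * d * hurwitz_zeta j.+2 y)%:E)%E.
Proof.
move=> y0; apply: nneseries_EFin.
have -> : (fun n => c * d * hurwitz_term j.+2 y n) = (c * d) *: hurwitz_term j.+2 y by [].
rewrite seriesZ; apply: cvgM; [exact: cvg_cst|exact: is_cvg_hurwitz].
Qed.

(** Writing [n + b = (y + n) - (y - b)] trades one power of [y + n] and leaves two Hurwitz zeta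
    values. *)
Lemma hurwitz_nneseries_affine (R : realType) (b d : R) (j : nat) (y : R) : 0 < y ->
  (\sum_(n <oo) ((n%:R + b) * d * hurwitz_term j.+3 y n)%:E =
   (d * (hurwitz_zeta j.+2 y - (y - b) * hurwitz_zeta j.+3 y))%:E)%E.
Proof.
move=> y0; apply: nneseries_EFin.
have -> : (fun n => (n%:R + b) * d * hurwitz_term j.+3 y n) =
    d *: (hurwitz_term j.+2 y - (y - b) *: hurwitz_term j.+3 y).
  apply/funext => n; change ((n%:R + b) * d * hurwitz_term j.+3 y n =
    d * (hurwitz_term j.+2 y n - (y - b) * hurwitz_term j.+3 y n)).
  have yn : y + n%:R != 0 by rewrite gt_eqF // ltr_wpDr.
  by rewrite /hurwitz_term [_ ^+ j.+3]exprS; field; rewrite yn ?expf_neq0.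
rewrite seriesZ; apply: cvgM; first exact: cvg_cst.
rewrite seriesD seriesN seriesZ; apply: cvgB; first exact: is_cvg_hurwitz.
by apply: cvgM; [exact: cvg_cst|exact: is_cvg_hurwitz].
Qed.

(** Constant coefficients [c] with weight [t^(j+1)] are compared with coefficients [n + b] and
    weight [t^(j+2)]. Both integrands share a positive factor, and what remains is the hypothesis on
    [c]. *)
Lemma hurwitz_ratio_ge (R : realType) (b c y : R) (j : nat) :
  0 <= b -> 0 <= c -> 0 < y ->
  (forall t, 0 < t -> c <= t * ((expR t - 1)^-1 + b)) ->
  j.+2%:R * (y - b) * hurwitz_zeta j.+3 y <= (j.+2%:R - c) * hurwitz_zeta j.+2 y.
Proof.
move=> b0 c0 y0 h.
have := @laplace_series_le R (fun=> c) (fun n => n%:R + b) j.+1 j.+2 y.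
rewrite hurwitz_nneseries_cst // hurwitz_nneseries_affine // lee_fin => H.
have {H} : c * (j.+1)`!%:R * hurwitz_zeta j.+2 y <=
    (j.+2)`!%:R * (hurwitz_zeta j.+2 y - (y - b) * hurwitz_zeta j.+3 y).
  apply: H => // [n|t t0]; first by rewrite addr_ge0.
  rewrite laplace_series_cst // laplace_series_affine // lee_fin.
  rewrite [leRHS](_ : _ = t ^+ j.+1 * expR (- (y * t)) *
    (t * ((expR t - 1)^-1 + b) / (1 - expR (- t)))); last by rewrite (exprSr t j.+1); ring.
  apply: ler_wpM2l; first by rewrite mulr_ge0 ?exprn_ge0 ?expR_ge0 ?(ltW t0).
  apply: ler_wpM2r; last exact: h.
  by rewrite invr_ge0 subr_ge0 ltW // expR_lt1 oppr_lt0.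
rewrite [(j.+2)`!]factS natrM; have : 0 < (j.+1)`!%:R :> R by rewrite ltr0n fact_gt0.
move: (j.+1)`!%:R (hurwitz_zeta j.+2 y) (hurwitz_zeta j.+3 y) => f z1 z2 f0 H.
have : f * (c * z1) <= f * (j.+2%:R * (z1 - (y - b) * z2)) by lra.
rewrite ler_pM2l //; lra.
Qed.

Lemma hurwitz_ratio_le (R : realType) (b c y : R) (j : nat) :
  0 <= b -> 0 <= c -> 0 < y ->
  (forall t, 0 < t -> t * ((expR t - 1)^-1 + b) <= c) ->
  (j.+2%:R - c) * hurwitz_zeta j.+2 y <= j.+2%:R * (y - b) * hurwitz_zeta j.+3 y.
Proof.
move=> b0 c0 y0 h.
have := @laplace_series_le R (fun n => n%:R + b) (fun=> c) j.+2 j.+1 y.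
rewrite hurwitz_nneseries_cst // hurwitz_nneseries_affine // lee_fin => H.
have {H} : (j.+2)`!%:R * (hurwitz_zeta j.+2 y - (y - b) * hurwitz_zeta j.+3 y) <=
    c * (j.+1)`!%:R * hurwitz_zeta j.+2 y.
  apply: H => // [n|t t0]; first by rewrite addr_ge0.
  rewrite laplace_series_cst // laplace_series_affine // lee_fin.
  rewrite [leLHS](_ : _ = t ^+ j.+1 * expR (- (y * t)) *
    (t * ((expR t - 1)^-1 + b) / (1 - expR (- t)))); last by rewrite (exprSr t j.+1); ring.
  apply: ler_wpM2l; first by rewrite mulr_ge0 ?exprn_ge0 ?expR_ge0 ?(ltW t0).
  apply: ler_wpM2r; last exact: h.
  by rewrite invr_ge0 subr_ge0 ltW // expR_lt1 oppr_lt0.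
rewrite [(j.+2)`!]factS natrM; have : 0 < (j.+1)`!%:R :> R by rewrite ltr0n fact_gt0.
move: (j.+1)`!%:R (hurwitz_zeta j.+2 y) (hurwitz_zeta j.+3 y) => f z1 z2 f0 H.
have : f * (j.+2%:R * (z1 - (y - b) * z2)) <= f * (c * z1) by lra.
rewrite ler_pM2l //; lra.
Qed.

(** * The function delta and its inverse *)

Lemma is_derive_ge0_le (R : realType) (f f' : R -> R) (a b : R) : a <= b ->
  (forall x : R, a <= x <= b -> is_derive x 1 f (f' x)) ->
  (forall x, a <= x <= b -> 0 <= f' x) -> f a <= f b.
Proof.
move=> ab df f0.
have [x xab||c cab e] := @MVT_segment R f f' a b ab.
- by apply: df; have := subset_itv_oo_cc xab; rewrite /= in_itv.
- apply: derivable_within_continuous => x xab.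
  by have [] // : is_derive x 1 f (f' x); apply: df; rewrite in_itv in xab.
- by rewrite -subr_ge0 e mulr_ge0 ?subr_ge0 // f0.
Qed.

(** The expression vanishes at [0], and its derivative [(x - 1) * expR x + 1] is nonnegative because
    [1 - x <= expR (- x)]. It governs both the monotonicity of [delta] and the threshold [1/2] for
    [beta]. *)
Lemma expR_quotient_numer_ge0 (R : realType) (t : R) : 0 <= t ->
  0 <= (t - 2) * expR t + t + 2.
Proof.
move=> t0; have -> : 0 = (0 - 2) * expR 0 + 0 + 2 :> R by rewrite expR0; ring.
apply: (@is_derive_ge0_le _ (fun x => (x - 2) * expR x + x + 2)
  (fun x => (x - 1) * expR x + 1)) => // x /andP[x0 _].
  apply: is_derive_eq; rewrite /GRing.scale /=; ring.
have := expR_ge1Dx (- x); rewrite expRN -subr_ge0 => h.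
have := mulr_ge0 (expR_ge0 x) h; rewrite mulrBr mulfV ?gt_eqF ?expR_gt0 //.
move: (expR x) => e; lra.
Qed.

Lemma is_derive_delta (R : realType) (t : R) : 0 < t ->
  is_derive t 1 (@delta R)
   (- (expR t * ((t - 2) * expR t + t + 2) / (expR t - 1) ^+ 3)).
Proof.
move=> t0; have e1 : expR t - 1 != 0 by rewrite gt_eqF // subr_gt0 expR_gt1.
have d1 : is_derive t 1 (fun x : R => expR x * (x - 1) + 1) (t * expR t).
  by apply: is_derive_eq; rewrite /GRing.scale /=; ring.
have d2 : is_derive t 1 (fun x : R => (expR x - 1) ^+ 2) (2 * (expR t - 1) * expR t).
  by apply: is_derive_eq; rewrite /GRing.scale /=; ring.
have d2n : (expR t - 1) ^+ 2 != 0 by rewrite expf_neq0.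
have d3 := @is_deriveV R (fun x : R => (expR x - 1) ^+ 2) t _ 1 d2n d2.
have d := is_deriveM d1 d3.
apply: (@is_derive_eq _ _ _ _ _ _ _ _ d).
by rewrite /GRing.scale /=; field.
Qed.

Lemma delta_nincr (R : realType) (s t : R) : 0 < s -> s <= t -> delta t <= delta s.
Proof.
move=> s0 st; rewrite -lerN2.
apply: (@is_derive_ge0_le _ (fun x => - delta x)
  (fun t => (expR t * ((t - 2) * expR t + t + 2) / (expR t - 1) ^+ 3))) => // x /andP[sx _].
  rewrite -[X in is_derive _ _ _ X]opprK; apply: is_deriveN; apply: is_derive_delta.
  exact: lt_le_trans sx.
have x0 := le_trans (ltW s0) sx.
by rewrite divr_ge0 ?mulr_ge0 ?expR_ge0 ?expR_quotient_numer_ge0 ?exprn_ge0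
  ?subr_ge0 -?expR0 ?ler_expR.
Qed.

Lemma delta_surj (R : realType) (b : R) : 0 < b < 2^-1 ->
  exists2 t : R, 0 < t & delta t = b.
Proof.
move=> /andP[b0 b1].
(* [t1] solves [b * exp (2 t) = 1/2]; since [exp t * (t - 1) + 1 >= t^2 / 2] and
   [exp t - 1 <= t * exp t], this gives [delta t1 >= b]. For [t2], the bounds
   [delta t <= t / (exp t - 1) <= 2 / t] give [delta t2 <= b]. *)
pose t1 : R := - ln (2 * b) / 2; pose t2 := 2 / b.
have t20 : 0 < t2 by rewrite divr_gt0.
have t10 : 0 < t1 by rewrite divr_gt0 // oppr_gt0 ln_lt0 // mulr_gt0 //=; lra.
have em1 (t : R) : 0 < t -> 0 < expR t - 1 by move=> t0; rewrite subr_gt0 expR_gt1.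
have h1 : b <= delta t1.
  have n1 : t1 ^+ 2 / 2 <= expR t1 * (t1 - 1) + 1.
    rewrite -subr_ge0; have -> : 0 = expR 0 * (0 - 1) + 1 - 0 ^+ 2 / 2 :> R.
      by rewrite expR0; ring.
    apply: (@is_derive_ge0_le _ (fun x => expR x * (x - 1) + 1 - x ^+ 2 / 2)
      (fun x => x * (expR x - 1))) => [|x _|x /andP[x0 _]]; first exact: ltW.
      by apply: is_derive_eq; rewrite /GRing.scale /=; field.
    by rewrite mulr_ge0 // subr_ge0 -expR0 ler_expR.
  have n2 : expR t1 - 1 <= t1 * expR t1.
    have := expR_ge1Dx (- t1); rewrite expRN -subr_ge0 => h.
    have := mulr_ge0 (expR_ge0 t1) h; rewrite mulrBr mulfV ?gt_eqF ?expR_gt0 //.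
    move: (expR t1) => e; lra.
  have n3 : b * expR t1 ^+ 2 = 2^-1.
    rewrite -expRM_natl /t1 (_ : 2%:R * (- ln (2 * b) / 2) = - ln (2 * b)); last by field.
    by rewrite expRN lnK ?posrE ?mulr_gt0 //; field; rewrite gt_eqF.
  rewrite /delta ler_pdivlMr ?exprn_gt0 ?em1 // (le_trans _ n1) //.
  apply: (@le_trans _ _ (b * (t1 * expR t1) ^+ 2)).
    by rewrite ler_wpM2l ?(ltW b0) // lerXn2r // ?nnegrE
      ?(ltW (em1 _ t10)) // mulr_ge0 ?expR_ge0 ?ltW.
  by rewrite exprMn mulrCA n3.
have h2 : delta t2 <= b.
  have n1 := expR_ge1Dx t2.
  have n2 := @expR_ge1Dxn R t2 1 (ltW t20).
  have e0 := em1 _ t20.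
  rewrite /delta ler_pdivrMr ?exprn_gt0 //.
  apply: (@le_trans _ _ (t2 * (expR t2 - 1))); first by lra.
  rewrite expr2 mulrA ler_wpM2r ?(ltW e0) //.
  apply: (@le_trans _ _ (b * (t2 ^+ 2 / 2))).
    by rewrite le_eqVlt; apply/orP; left; apply/eqP; rewrite /t2; field; rewrite gt_eqF.
  by rewrite ler_wpM2l ?(ltW b0) // lerBrDl.
have ct (u v : R) : 0 < u -> {within `[u, v], continuous (@delta R)}.
  move=> u0; apply: derivable_within_continuous => x; rewrite in_itv /= => /andP[ux _].
  by have [] // := is_derive_delta (lt_le_trans u0 ux).
have I (u v : R) : 0 < u -> u <= v ->
    Num.min (delta u) (delta v) <= b <= Num.max (delta u) (delta v) ->
    exists2 t : R, 0 < t & delta t = b.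
  move=> u0 uv h; have [c cuv cb] := IVT uv (ct u v u0) h.
  exists c => //; move: cuv; rewrite in_itv /= => /andP[uc _].
  exact: lt_le_trans uc.
have [t12|t21] := lerP t1 t2.
  by apply: (I t1 t2) => //; rewrite ge_min le_max h1 h2 orbT.
by apply: (I t2 t1) => //; rewrite ?(ltW t21) // ge_min le_max h1 h2 orbT.
Qed.

(** Surjectivity onto the open interval makes the partial inverse a right inverse with values in the
    positive half-line, away from its default value. *)
Lemma delta_invP (R : realType) (b : R) : 0 < b < 2^-1 ->
  0 < delta_inv b /\ delta (delta_inv b) = b.
Proof.
move=> hb; have [t t0 tb] := delta_surj hb.
have sj : set_surj `]0, +oo[%classic `]0, 2^-1[%classic (@delta R).
  move=> c /=; rewrite in_itv /= => /delta_surj [s s0 sc].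
  by exists s => //=; rewrite in_itv /= s0.
have bI : `]0, 2^-1[%classic b by rewrite /= in_itv.
split.
  have := surjpinv_image_sub sj.
  move=> /(_ (fun=> 0) (delta_inv b)) /=; rewrite in_itv /= andbT; apply.
  by exists b.
by apply: (surjpK (fun=> 0) sj); rewrite inE.
Qed.

(** The generating function [t / (exp t - 1)] of the Bernoulli numbers, plus the linear term
    [b * t]. *)
Definition bernoulli_slope (R : realType) (b t : R) : R := t * ((expR t - 1)^-1 + b).

Lemma is_derive_bernoulli_slope (R : realType) (b t : R) : 0 < t ->
  is_derive t 1 (bernoulli_slope b) (b - delta t).
Proof.
move=> t0; have e1 : expR t - 1 != 0 by rewrite gt_eqF // subr_gt0 expR_gt1.
have d1 : is_derive t 1 (fun x : R => expR x - 1) (expR t).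
  by apply: is_derive_eq; rewrite subr0.
have d2 := is_deriveD (@is_deriveV R (fun x : R => expR x - 1) t _ 1 e1 d1)
  (is_derive_cst b t (1 : R)).
have d := is_deriveM (is_derive_id t (1 : R)) d2.
apply: (@is_derive_eq _ _ _ (bernoulli_slope b) t 1 _ _ d).
change (t * (- (expR t - 1) ^- 2 * expR t + 0) + ((expR t - 1)^-1 + b) * 1 = b - delta t).
by rewrite /delta; field.
Qed.

Lemma bernoulli_slope_min (R : realType) (b t : R) : 0 < b < 2^-1 -> 0 < t ->
  bernoulli_slope b (delta_inv b) <= bernoulli_slope b t.
Proof.
move=> /delta_invP; move: (delta_inv b) => T [T0 Tb] t0.
have [Tt|/ltW tT] := lerP T t.
  apply: (@is_derive_ge0_le _ _ (fun x => b - delta x)) Tt _ _ => x /andP[Tx _].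
    by apply: is_derive_bernoulli_slope; exact: lt_le_trans Tx.
  by rewrite -Tb subr_ge0 delta_nincr.
rewrite -lerN2.
apply: (@is_derive_ge0_le _ (fun x => - bernoulli_slope b x) (fun x => - (b - delta x))) tT _ _
    => x /andP[tx xT].
  by apply: is_deriveN; apply: is_derive_bernoulli_slope; exact: lt_le_trans tx.
by rewrite opprB subr_ge0 -Tb delta_nincr // (lt_le_trans t0).
Qed.

Lemma bernoulli_slope_ge0 (R : realType) (b t : R) : 0 <= b -> 0 < t ->
  0 <= bernoulli_slope b t.
Proof.
move=> b0 t0; rewrite mulr_ge0 ?(ltW t0) // addr_ge0 // invr_ge0 subr_ge0.
by rewrite ltW // expR_gt1.
Qed.

Lemma bernoulli_slope0_le1 (R : realType) (t : R) : 0 < t -> bernoulli_slope 0 t <= 1.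
Proof.
move=> t0; rewrite /bernoulli_slope addr0 ler_pdivrMr ?subr_gt0 ?expR_gt1 // mul1r.
by rewrite lerBrDl expR_ge1Dx.
Qed.

(** By monotonicity in [b] it is enough to treat [b = 1/2], where clearing denominators leaves
    [expR_quotient_numer_ge0]. *)
Lemma bernoulli_slope_ge1 (R : realType) (b t : R) : 2^-1 <= b -> 0 < t ->
  1 <= bernoulli_slope b t.
Proof.
move=> hb t0; have e1 : 0 < expR t - 1 by rewrite subr_gt0 expR_gt1.
apply: (@le_trans _ _ (bernoulli_slope 2^-1 t)); last first.
  by rewrite ler_wpM2l ?(ltW t0) // lerD2l.
have -> : bernoulli_slope 2^-1 t = (t + t * (expR t - 1) / 2) / (expR t - 1).
  by rewrite /bernoulli_slope; field; rewrite gt_eqF.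
rewrite ler_pdivlMr // mul1r.
have := expR_quotient_numer_ge0 (ltW t0); lra.
Qed.

(** * Size of the Hurwitz zeta function near zero and at infinity *)

Lemma hurwitz_zeta1D (R : realType) (j : nat) (x : R) : 0 < x ->
  hurwitz_zeta j.+2 x = x ^- j.+2 + hurwitz_zeta j.+2 (x + 1).
Proof.
move=> x0; have x1 : 0 < x + 1 by rewrite addr_gt0.
have c1 := @is_cvg_hurwitz R j _ x0; have c2 := @is_cvg_hurwitz R j _ x1.
apply/cvg_lim => //; rewrite -cvg_shiftS.
have -> : (fun n => series (hurwitz_term j.+2 x) n.+1) =
    (fun n => x ^- j.+2 + series (hurwitz_term j.+2 (x + 1)) n).
  apply/funext => n; rewrite /series /= big_nat_recl // /hurwitz_term addr0.
  by congr (_ + _); apply: eq_bigr => k _; rewrite -natr1 (addrC k%:R) addrA.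
by apply: cvgD; [exact: cvg_cst|exact: c2].
Qed.

Lemma exprVn_le_hurwitz_zeta (R : realType) (j : nat) (x : R) : 0 < x ->
  x ^- j.+2 <= hurwitz_zeta j.+2 x.
Proof.
move=> x0; rewrite hurwitz_zeta1D // lerDl ltW // hurwitz_zeta_gt0 //.
by rewrite addr_gt0.
Qed.

Lemma series_hurwitz_telescope (R : realType) (j : nat) (y : R) (n : nat) :
  series (fun k => hurwitz_term j y k - hurwitz_term j y k.+1) n =
  y ^- j - hurwitz_term j y n.
Proof.
elim: n => [|n IH]; first by rewrite /series /= big_nil /hurwitz_term addr0 subrr.
rewrite seriesSr IH; ring.
Qed.

(** A discrete integral test: by the tangent inequality, [j + 1] times a term is compared with
    differences of consecutive [(y + k)^-(j+1)], whose series telescopes to [y^-(j+1)]. *)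
Lemma hurwitz_zeta_bounds (R : realType) (j : nat) (y : R) : 0 < y ->
  y ^- j.+1 <= j.+1%:R * hurwitz_zeta j.+2 y <= y ^- j.+1 + j.+1%:R * y ^- j.+2.
Proof.
move=> y0; have yk (k : nat) : 0 < y + k%:R by rewrite ltr_wpDr.
pose d k := hurwitz_term j.+1 y k - hurwitz_term j.+1 y k.+1.
have cd : series d n @[n --> \oo] --> y ^- j.+1.
  have -> : series d = (fun n => y ^- j.+1 - hurwitz_term j.+1 y n).
    by apply/funext => n; rewrite series_hurwitz_telescope.
  rewrite -[X in _ --> X]subr0; apply: cvgB; first exact: cvg_cst.
  have -> : hurwitz_term j.+1 y = (fun n => (y + n%:R)^-1 ^+ j.+1).
    by apply/funext => n; rewrite exprVn.
  have -> : 0 = 0 ^+ j.+1 :> R by rewrite expr0n.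
  apply: (@cvg_comp _ _ _ (fun n : nat => (y + n%:R)^-1) (fun x : R => x ^+ j.+1) _ (nbhs (0 : R))).
    exact: cvg_inv_addn.
  exact: exprn_continuous.
have ds : limn (series d) = y ^- j.+1 by apply/cvg_lim.
have cdc : cvgn (series d) by apply/cvg_ex; exists (y ^- j.+1).
have Z (x : R) (x0 : 0 < x) := lim_seriesZ j.+1%:R (@is_cvg_hurwitz R j x x0).
have CZ (x : R) (x0 : 0 < x) : cvgn (series (j.+1%:R *: hurwitz_term j.+2 x)).
  exact/is_cvg_seriesZ/is_cvg_hurwitz.
have e1 (k : nat) : y + k.+1%:R - (y + k%:R) = 1 by rewrite -natr1; ring.
have y1 : 0 < y + 1 by rewrite addr_gt0.
apply/andP; split.
  rewrite -ds -[leRHS](Z _ y0); apply: lim_series_le => //; first exact: CZ.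
  move=> k; change (d k <= j.+1%:R * hurwitz_term j.+2 y k).
  have := exprVn_tangent j.+1 (yk k) (yk k.+1); rewrite e1 mulr1 /d /hurwitz_term.
  by move: (_ ^- j.+2) => p h; lra.
(* Once the first term is split off, the shifted series is dominated by the same telescoping
   series. *)
rewrite hurwitz_zeta1D // mulrDr addrC lerD2r.
rewrite -ds -[leLHS](Z _ y1); apply: lim_series_le => //; first exact: CZ.
move=> k; change (j.+1%:R * hurwitz_term j.+2 (y + 1) k <= d k).
have := exprVn_tangent j.+1 (yk k.+1) (yk k).
rewrite -opprB e1 /d /hurwitz_term -addrA (addrC 1) natr1.
by move: (_ ^- j.+2) => p h; lra.
Qed.

(** * Sufficient conditions *)

Lemma ratio_familyE (R : realType) (i k : nat) (e a b x : R) :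
  ratio_family i.+1 e a b k x = ((i + k).+1)`!%:R *
    (e * ((a + k%:R) * hurwitz_zeta (i + k).+2 (x + b) -
       (i + k).+2%:R * x * hurwitz_zeta (i + k).+3 (x + b))).
Proof.
rewrite /ratio_family /polygamma_abs addSn [((i + k).+2)`!]factS natrM.
by move: (hurwitz_zeta _.+2 _) (hurwitz_zeta _.+3 _) => p q; ring.
Qed.

(** Common source of three sufficiency claims, with [c] a lower bound of the slope function. The
    condition on [a] passes to every [k], since [i] and [a] grow together. *)
Lemma completely_monotonic_ratio_ge (R : realType) (i : nat) (a b c : R) :
  (1 <= i)%N -> 0 <= b -> 0 <= c ->
  (forall t, 0 < t -> c <= bernoulli_slope b t) -> i%:R + 1 - c <= a ->
  completely_monotonic `]0, +oo[ (fun x : R =>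
    a / x * `|polygamma i (x + b)| - `|polygamma i.+1 (x + b)|).
Proof.
case: i => // i hi b0 c0 hc ha.
apply: (@completely_monotonic_ratio _ i.+1 1 a b) => // [x x0|k x x0].
  by rewrite mul1r.
have y0 : 0 < x + b by rewrite ltr_wpDr.
rewrite ratio_familyE mul1r mulr_ge0 // subr_ge0.
have := @hurwitz_ratio_ge R b c (x + b) (i + k) b0 c0 y0 hc.
rewrite addrK => /le_trans; apply.
apply: ler_wpM2r; first exact/ltW/hurwitz_zeta_gt0.
by move: ha; rewrite -!natr1 natrD; lra.
Qed.

(** The reversed difference, with sign [-1], no shift, and the upper bound [1] of
    [t / (exp t - 1)]. *)
Lemma completely_monotonic_ratio_le (R : realType) (i : nat) (a : R) :
  (1 <= i)%N -> a <= i%:R ->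
  completely_monotonic `]0, +oo[ (fun x : R =>
    `|polygamma i.+1 x| - a / x * `|polygamma i x|).
Proof.
case: i => // i hi ha.
apply: (@completely_monotonic_ratio _ i.+1 (-1) a 0) => // [x x0|k x x0].
  by rewrite addr0 mulN1r opprB.
rewrite ratio_familyE addr0 mulN1r opprB mulr_ge0 // subr_ge0.
have := @hurwitz_ratio_le R 0 1 x (i + k) (lexx _) ler01 x0 (@bernoulli_slope0_le1 R).
rewrite subr0; apply: le_trans.
apply: ler_wpM2r; first exact/ltW/hurwitz_zeta_gt0.
by move: ha; rewrite -!natr1 natrD; lra.
Qed.

(** * Necessary conditions, drawn from the sign of the function itself *)

Lemma completely_monotonic_ge0 (R : realType) (f : R -> R) (x : R) :
  completely_monotonic `]0, +oo[ f -> 0 < x -> 0 <= f x.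
Proof.
move=> cm x0; have : `]0, +oo[%classic x by rewrite /= in_itv /= x0.
by move=> /(cm 0%N) [_]; rewrite derive1n0 expr0 mul1r.
Qed.

Lemma polygamma_ratioE (R : realType) (i : nat) (a x y : R) : 0 < y ->
  a / x * `|polygamma i.+1 y| - `|polygamma i.+2 y| =
  (i.+1)`!%:R * (a / x * hurwitz_zeta i.+2 y - i.+2%:R * hurwitz_zeta i.+3 y).
Proof.
move=> y0; rewrite !normr_polygamma // [(i.+2)`!]factS natrM.
by move: (hurwitz_zeta i.+2 _) (hurwitz_zeta i.+3 _) => p q; ring.
Qed.

Lemma polygamma_ratio_ge0 (R : realType) (i : nat) (a x y : R) : 0 < x -> 0 < y ->
  0 <= a / x * `|polygamma i.+1 y| - `|polygamma i.+2 y| ->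
  i.+2%:R * x * hurwitz_zeta i.+3 y <= a * hurwitz_zeta i.+2 y.
Proof.
move=> x0 y0; rewrite polygamma_ratioE // pmulr_rge0 ?ltr0n ?fact_gt0 // => h.
rewrite -subr_ge0; have := mulr_ge0 (ltW x0) h.
move: (hurwitz_zeta i.+2 _) (hurwitz_zeta i.+3 _) => p q.
by rewrite (_ : x * _ = a * p - i.+2%:R * x * q) //; field; rewrite gt_eqF.
Qed.

Lemma polygamma_ratio_le0 (R : realType) (i : nat) (a x y : R) : 0 < x -> 0 < y ->
  0 <= `|polygamma i.+2 y| - a / x * `|polygamma i.+1 y| ->
  a * hurwitz_zeta i.+2 y <= i.+2%:R * x * hurwitz_zeta i.+3 y.
Proof.
move=> x0 y0; rewrite -opprB oppr_ge0 polygamma_ratioE //.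
rewrite pmulr_rle0 ?ltr0n ?fact_gt0 // => h.
rewrite -subr_le0; have := mulr_ge0_le0 (ltW x0) h.
move: (hurwitz_zeta i.+2 _) (hurwitz_zeta i.+3 _) => p q.
by rewrite (_ : x * _ = a * p - i.+2%:R * x * q) //; field; rewrite gt_eqF.
Qed.

(** As [x] tends to [0] the term of index [0] dominates both zeta values; multiplying by [x^(i+2)]
    leaves [i + 2 <= a + c * x^(i+2)]. *)
Lemma hurwitz_ratio_at0 (R : realType) (i : nat) (a : R) :
  (forall x, 0 < x -> i.+2%:R * x * hurwitz_zeta i.+3 x <= a * hurwitz_zeta i.+2 x) ->
  i.+2%:R <= a.
Proof.
move=> h; have Z0 := @hurwitz_zeta_gt0 R i 1 ltr01.
have a0 : 0 < a.
  have := h 1 ltr01; rewrite mulr1; apply: contraTT; rewrite -leNgt -ltNge => a0.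
  rewrite (@le_lt_trans _ _ 0) ?mulr_gt0 ?hurwitz_zeta_gt0 //.
  by rewrite mulr_le0_ge0 // ltW.
apply/ler_addgt0Pr => e e0; pose c := a * hurwitz_zeta i.+2 1.
have c0 : 0 < c by rewrite mulr_gt0.
(* The bound [1] gives [x^(i+2) <= x], and [e / c] then keeps the error below [e]. *)
pose x := Num.min 1 (e / c).
have x0 : 0 < x by rewrite lt_min ltr01 divr_gt0.
have x1 : x <= 1 by rewrite ge_min lexx.
have xe : c * x <= e by rewrite mulrC -ler_pdivlMr // ge_min lexx orbT.
have p0 : 0 < x ^+ i.+2 by rewrite exprn_gt0.
have px : x ^+ i.+2 <= x by rewrite -[leRHS]expr1 ler_wiXn2l // ltW.
have low : x ^- i.+2 <= x * hurwitz_zeta i.+3 x.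
  apply: le_trans (ler_wpM2l (ltW x0) (exprVn_le_hurwitz_zeta i.+1 x0)).
  rewrite [x ^+ i.+3]exprS le_eqVlt; apply/orP; left; apply/eqP.
  by move: (x ^+ i.+2) p0 => p p0; field; rewrite !gt_eqF.
have up : hurwitz_zeta i.+2 x <= x ^- i.+2 + hurwitz_zeta i.+2 1.
  by rewrite hurwitz_zeta1D // lerD2l hurwitz_zeta_nincr // lerDr ltW.
have : i.+2%:R * x ^- i.+2 <= a * (x ^- i.+2 + hurwitz_zeta i.+2 1).
  apply: le_trans (ler_wpM2l (ltW a0) up); apply: le_trans (h x x0).
  by rewrite -mulrA ler_wpM2l.
move=> /(ler_wpM2r (ltW p0)); rewrite -mulrA mulVf ?gt_eqF // mulr1.
rewrite -mulrA mulrDl mulVf ?gt_eqF // mulrDr mulr1 mulrA -/c => H.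
apply: (le_trans H); rewrite lerD2l (le_trans _ xe) //.
by rewrite ler_wpM2l // ltW.
Qed.

(** Inserting the bounds on both zeta values and multiplying by [x^(i+1)] gives
    [a <= i + 1 + c / x]; the choice [x = c / e] turns the error into [e]. *)
Lemma hurwitz_ratio_atoo_le (R : realType) (i : nat) (a : R) :
  (forall x, 0 < x -> a * hurwitz_zeta i.+2 x <= i.+2%:R * x * hurwitz_zeta i.+3 x) ->
  a <= i.+1%:R.
Proof.
move=> h; have [a0|a0] := lerP a 0; first exact: le_trans a0 _.
apply/ler_addgt0Pr => e e0; pose c : R := i.+1%:R * i.+2%:R.
have c0 : 0 < c by rewrite mulr_gt0.
pose x := c / e; have x0 : 0 < x by rewrite divr_gt0.
have /andP[low _] := hurwitz_zeta_bounds i x0.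
have /andP[_ up] := hurwitz_zeta_bounds i.+1 x0.
have p0 : 0 < x ^+ i.+1 by rewrite exprn_gt0.
have h1 : a * x ^- i.+1 <= i.+1%:R * (a * hurwitz_zeta i.+2 x).
  by rewrite (mulrCA _ a) ler_wpM2l // ltW.
have h2 : i.+2%:R * x * hurwitz_zeta i.+3 x <= x * (x ^- i.+2 + i.+2%:R * x ^- i.+3).
  by rewrite (mulrC _ x) -mulrA ler_wpM2l // ltW.
have := le_trans h1 (ler_wpM2l (ler0n _ _) (le_trans (h x x0) h2)).
move=> /(ler_wpM2r (ltW p0)); rewrite divfK ?gt_eqF //.
move=> H; apply: (le_trans H); rewrite le_eqVlt; apply/orP; left; apply/eqP.
have -> : e = c / x by rewrite /x; field; rewrite !gt_eqF.
rewrite /c [x ^+ i.+3]exprS [x ^+ i.+2]exprS.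
move: (x ^+ i.+1) p0 => p p0; field.
by rewrite !gt_eqF.
Qed.

Lemma hurwitz_ratio_atoo_ge (R : realType) (i : nat) (a b : R) : 0 <= b ->
  (forall x, 0 < x ->
    i.+2%:R * x * hurwitz_zeta i.+3 (x + b) <= a * hurwitz_zeta i.+2 (x + b)) ->
  i.+1%:R <= a.
Proof.
move=> b0 h.
have a0 : 0 < a.
  have y0 : 0 < 1 + b by rewrite ltr_wpDr.
  have := h 1 ltr01; rewrite mulr1; apply: contraTT; rewrite -leNgt -ltNge => a0.
  rewrite (@le_lt_trans _ _ 0) ?mulr_gt0 ?hurwitz_zeta_gt0 //.
  by rewrite mulr_le0_ge0 // ltW ?hurwitz_zeta_gt0.
(* The bounds at [y = x + b] give [(i + 1) * x <= a * (y + i + 1)]. The constant [c] collects the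
   excess [a * (i + 1)] and the cost [b * (i + 1)] of replacing [x] by [y]. *)
apply/ler_addgt0Pr => e e0; pose c : R := (a + b) * i.+1%:R.
have c0 : 0 < c by rewrite mulr_gt0 // ltr_wpDr.
pose x := c / e; have x0 : 0 < x by rewrite divr_gt0.
have xe : c = e * x by rewrite /x mulrC divfK // gt_eqF.
clearbody x.
have := h x x0; pose y := x + b; rewrite -/y.
have xy : x = y - b by rewrite /y addrK.
have y0 : 0 < y by rewrite ltr_wpDr.
have /andP[low _] := hurwitz_zeta_bounds i.+1 y0.
have /andP[_ up] := hurwitz_zeta_bounds i y0.
have p0 : 0 < y ^+ i.+2 by rewrite exprn_gt0.
move=> H.
have h1 : x * y ^- i.+2 <= a * hurwitz_zeta i.+2 y.
  by apply: le_trans H; rewrite (mulrC _ x) -mulrA ler_wpM2l // ltW.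
have h2 : i.+1%:R * (a * hurwitz_zeta i.+2 y) <= a * (y ^- i.+1 + i.+1%:R * y ^- i.+2).
  by rewrite (mulrCA _ a) ler_wpM2l // ltW.
have := le_trans (ler_wpM2l (ler0n _ i.+1) h1) h2.
move=> /(ler_wpM2r (ltW p0)).
have -> : i.+1%:R * (x / y ^+ i.+2) * y ^+ i.+2 = i.+1%:R * x.
  by field; rewrite gt_eqF.
have -> : a * (y ^- i.+1 + i.+1%:R / y ^+ i.+2) * y ^+ i.+2 = a * (y + i.+1%:R).
  rewrite [y ^+ i.+2]exprS; have : 0 < y ^+ i.+1 by rewrite exprn_gt0.
  by move: (y ^+ i.+1) => p pp; field; rewrite !gt_eqF.
move=> H2; rewrite -(ler_pM2r y0).
have : e * x <= e * y by rewrite ler_wpM2l ?(ltW e0) // /y lerDl.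
rewrite -xe /c; move: H2; rewrite {1}xy; lra.
Qed.

Unset Implicit Arguments.
Set Strict Implicit.
Set Printing Implicit Defensive.

Theorem corollary2 (R : realType) (i : nat) (alpha beta : R)
    (hi : (1 <= i)%N) (hbeta : 0 <= beta) :
  [/\ completely_monotonic `]0, +oo[
        (fun x : R => alpha / x * `|polygamma i x| - `|polygamma i.+1 x|)
        <-> i%:R + 1 <= alpha,
      completely_monotonic `]0, +oo[
        (fun x : R => `|polygamma i.+1 x| - alpha / x * `|polygamma i x|)
        <-> alpha <= i%:R,
      2^-1 <= beta ->
        (completely_monotonic `]0, +oo[
          (fun x : R => alpha / x * `|polygamma i (x + beta)|
                        - `|polygamma i.+1 (x + beta)|)
          <-> i%:R <= alpha)
    & 0 < beta < 2^-1 ->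
        i%:R + 1 - (expR (delta_inv beta) / (expR (delta_inv beta) - 1)
                    + beta - 1) * delta_inv beta <= alpha ->
        completely_monotonic `]0, +oo[
          (fun x : R => alpha / x * `|polygamma i (x + beta)|
                        - `|polygamma i.+1 (x + beta)|)].
Proof.
split; [split|split|move=> hb; split|move=> hb ha].
- case: i hi => // i _ cm; rewrite natr1; apply: hurwitz_ratio_at0 => x x0.
  by apply: polygamma_ratio_ge0 => //; exact: (completely_monotonic_ge0 cm).
- move=> ha; have -> : (fun x : R => alpha / x * `|polygamma i x| - `|polygamma i.+1 x|) =
      (fun x => alpha / x * `|polygamma i (x + 0)| - `|polygamma i.+1 (x + 0)|).
    by apply/funext => x; rewrite addr0.
  (* Here [b = 0] and [c = 0], the limit of [t / (exp t - 1)] at infinity. *)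
  apply: (completely_monotonic_ratio_ge hi (lexx 0) (lexx 0)); last by rewrite subr0.
  by move=> t; exact: bernoulli_slope_ge0.
- case: i hi => // i _ cm; apply: hurwitz_ratio_atoo_le => x x0.
  by apply: polygamma_ratio_le0 => //; exact: (completely_monotonic_ge0 cm).
- exact: completely_monotonic_ratio_le.
- case: i hi => // i _ cm; apply: (hurwitz_ratio_atoo_ge hbeta) => x x0.
  have y0 : 0 < x + beta by rewrite ltr_wpDr.
  by apply: polygamma_ratio_ge0 => //; exact: (completely_monotonic_ge0 cm).
- move=> ha; apply: (completely_monotonic_ratio_ge hi hbeta ler01).
    by move=> t; exact: bernoulli_slope_ge1.
  by rewrite addrK.
- have [T0 _] := delta_invP hb.
  apply: (completely_monotonic_ratio_ge hi hbeta (bernoulli_slope_ge0 hbeta T0)).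
    by move=> t; exact: bernoulli_slope_min.
  (* Since [e^T / (e^T - 1) - 1 = 1 / (e^T - 1)], the bracket times [T = delta_inv beta] is the
     minimum of the slope function. *)
  apply: le_trans ha; rewrite lerD2l lerN2 le_eqVlt; apply/orP; left; apply/eqP.
  have : 0 < expR (delta_inv beta) - 1 by rewrite subr_gt0 expR_gt1.
  rewrite /bernoulli_slope; move: (delta_inv beta) => T e0; field.
  by rewrite gt_eqF.
Qed.
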